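(* If $A$ is a non-hereditary cluster-tilted algebra of type $\mathbb{E}_6$, then $\operatorname{Frobdim}(A)\geq 1$.
   Context: $\mathsf{k}$ is an algebraically closed field. For a $\mathsf{k}$-algebra $A$ with multiplication $m\colon A\otimes A\to A$, an open Frobenius coproduct is a $\mathsf{k}$-linear map $\Delta\colon A\to A\otimes A$ which is a morphism of $A$-bimodules, i.e. $(m\otimes 1)(1\otimes\Delta)=\Delta\circ m=(1\otimes m)(\Delta\otimes 1)$. These maps form a $\mathsf{k}$-vector space; its dimension is the Frobenius dimension $\operatorname{Frobdim}(A)$. Cluster-tilted algebras: let $H=\mathsf{k}Q$ be the path algebra of a quiver $Q$ whose underlying graph is a Dynkin diagram, $\mathcal{D}=\mathcal{D}^b(H)$ the bounded derived category of finitely generated $H$-modules, $[1]$ its shift functor and $\tau$ its Auslander–Reiten translation. The cluster category is the orbit category $\mathcal{C}=\mathcal{D}/F$ with $F=\tau^{-1}[1]$. An object $T$ of $\mathcal{C}$ is a tilting object if $\operatorname{Ext}^1_{\mathcal{C}}(T,T)=0$ and $T$ is maximal with respect to this property. The (basic) algebra $\operatorname{End}_{\mathcal{C}}(T)$ is called a cluster-tilted algebra; it is of type $\mathbb{E}_6$ if the underlying graph of $Q$ is the Dynkin diagram $\mathbb{E}_6$. Known equivalent description (Buan–Marsh–Reiten): the cluster-tilted algebras of type $\mathbb{E}_6$ are the algebras $\mathsf{k}Q/I$ where $Q$ is one of the 67 quivers in the (Fomin–Zelevinsky) mutation class of an orientation of $\mathbb{E}_6$ and $I$ is generated by the following relations: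 for each arrow $\alpha\colon i\to j$ consider the paths $p$ from $j$ to $i$ such that the full subquiver on the vertices of the oriented cycle $\alpha p$ is just that cycle; there are at most two of them; if there is exactly one, $p$, then $p$ is a (zero) relation, and if there are two, $p$ and $q$, then $p-q$ is a (commutativity) relation. The hereditary ones are exactly those whose quiver is an orientation of $\mathbb{E}_6$. *)

(* Defs.v *)
From HB Require Import structures.
From mathcomp Require Import all_boot all_order all_algebra all_field.
From mathcomp Require Import finmap.
From mathcomp Require Import monalg.

Set Implicit Arguments.
Unset Strict Implicit.
Unset Printing Implicit Defensive.

Import Order.TTheory GRing.Theory Num.Theory.
Import VectorInternalTheory.
Local Open Scope ring_scope.

Record quiver (n : nat) := Quiver {
  arrow : finType;
  src : arrow -> 'I_n;
  tgt : arrow -> 'I_n }.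

Section Paths.
Variables (n : nat) (Q : quiver n).

Fixpoint walk (i : 'I_n) (s : seq (arrow Q)) : bool :=
  if s is a :: s' then (src a == i) && walk (tgt a) s' else true.

Fixpoint walk_end (i : 'I_n) (s : seq (arrow Q)) : 'I_n :=
  if s is a :: s' then walk_end (tgt a) s' else i.

(* The starting vertex is recorded so that every vertex [i] has its own
   trivial path [(i, [::])]. *)
Record qpath := QPath {
  qpath_val : 'I_n * seq (arrow Q);
  _ : walk qpath_val.1 qpath_val.2 }.

HB.instance Definition _ := [isSub for qpath_val].
HB.instance Definition _ := [Choice of qpath by <:].

Definition psrc (p : qpath) : 'I_n := (val p).1.
Definition ptgt (p : qpath) : 'I_n := walk_end (val p).1 (val p).2.
Definition parrows (p : qpath) : seq (arrow Q) := (val p).2.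

Definition triv_path (i : 'I_n) : qpath := @QPath (i, [::]) isT.

Lemma walk_cat i s1 s2 :
  walk i (s1 ++ s2) = walk i s1 && walk (walk_end i s1) s2.
Proof. by elim: s1 i => //= a s1 IH i; rewrite IH andbA. Qed.

Lemma walk_end_cat i s1 s2 :
  walk_end i (s1 ++ s2) = walk_end (walk_end i s1) s2.
Proof. by elim: s1 i => //= a s1 IH i. Qed.

(* [p] followed by [q]; the default value [p] is only taken when the two paths
   are not composable. *)
Definition pcat (p q : qpath) : qpath :=
  insubd p (psrc p, parrows p ++ parrows q).

Lemma pcatE p q : ptgt p = psrc q ->
  val (pcat p q) = (psrc p, parrows p ++ parrows q).
Proof.
move=> e; rewrite /pcat insubdK // unfold_in /= walk_cat.
by apply/andP; split; [exact: (valP p) | have := valP q; rewrite -/(psrc q) -e].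
Qed.

Lemma psrc_pcat p q : ptgt p = psrc q -> psrc (pcat p q) = psrc p.
Proof. by move=> /pcatE; rewrite /psrc => ->. Qed.

Lemma ptgt_pcat p q : ptgt p = psrc q -> ptgt (pcat p q) = ptgt q.
Proof.
move=> e; rewrite {1}/ptgt (pcatE e) /= walk_end_cat.
by rewrite -[walk_end (psrc p) _]/(ptgt p) e.
Qed.

Lemma pcatA p q r : ptgt p = psrc q -> ptgt q = psrc r ->
  pcat p (pcat q r) = pcat (pcat p q) r.
Proof.
move=> epq eqr; apply: val_inj.
have e1 : ptgt p = psrc (pcat q r) by rewrite psrc_pcat.
have e2 : ptgt (pcat p q) = psrc r by rewrite ptgt_pcat.
rewrite (pcatE e1) (pcatE e2) psrc_pcat //; congr (_, _).
by rewrite /parrows pcatE // [in RHS]pcatE //= catA.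
Qed.

Lemma pcat1p p : pcat (triv_path (psrc p)) p = p.
Proof. by apply: val_inj; rewrite pcatE // /psrc /parrows /=; case: (val p). Qed.

Lemma pcatp1 p : pcat p (triv_path (ptgt p)) = p.
Proof.
by apply: val_inj; rewrite pcatE // /psrc /parrows /= cats0; case: (val p).
Qed.

End Paths.

Definition path_algebra (k : fieldType) n (Q : quiver n) := {malg k[qpath Q]}.
HB.instance Definition _ (k : fieldType) n (Q : quiver n) :=
  GRing.Lmodule.on (path_algebra k Q).

HB.lock Definition pathb (k : fieldType) n (Q : quiver n) (p : qpath Q) :
  path_algebra k Q := << p >>.

(* The linear extension of a function on paths. *)
HB.lock Definition linext (k : fieldType) n (Q : quiver n) (V : lmodType k)
    (h : qpath Q -> V) (x : path_algebra k Q) : V :=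
  \sum_(p <- msupp x) x@_p *: h p.

Definition pmul (k : fieldType) n (Q : quiver n) (p q : qpath Q) :
    path_algebra k Q :=
  if ptgt p == psrc q then pathb k (pcat p q) else 0.

HB.lock Definition kQmul (k : fieldType) n (Q : quiver n)
    (x y : path_algebra k Q) : path_algebra k Q :=
  linext (fun p => linext (@pmul k n Q p) y) x.

HB.lock Definition kQone (k : fieldType) n (Q : quiver n) : path_algebra k Q :=
  \sum_(i < n) pathb k (triv_path Q i).

Section PathAlgebra.
Variables (k : fieldType) (n : nat) (Q : quiver n).
Local Notation kQ := (path_algebra k Q).
Local Notation pathb := (pathb k).
Local Notation pmul := (@pmul k n Q).
Local Notation kQmul := (@kQmul k n Q).
Local Notation kQone := (@kQone k n Q).

Lemma linextEw (V : lmodType k) (h : qpath Q -> V) (d : {fset qpath Q}) x :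
  (msupp x `<=` d)%fset -> linext h x = \sum_(p <- d) x@_p *: h p.
Proof.
move=> le; rewrite linext.unlock (big_fset_incl _ le) // => p _ hp.
by rewrite mcoeff_outdom // scale0r.
Qed.

Lemma linext_is_linear (V : lmodType k) (h : qpath Q -> V) : linear (linext h).
Proof.
move=> c x y; pose d := (msupp x `|` msupp y `|` msupp (c *: x + y))%fset.
have lx : (msupp x `<=` d)%fset by rewrite /d -fsetUA fsubsetUl.
have ly : (msupp y `<=` d)%fset.
  by rewrite (fsubset_trans (fsubsetUr _ _) (fsubsetUl _ _)).
rewrite (linextEw _ lx) (linextEw _ ly) (@linextEw _ _ d) ?fsubsetUr //.
rewrite scaler_sumr -big_split /=; apply: eq_bigr => p _.
by rewrite mcoeffD mcoeffZ scalerDl scalerA.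
Qed.
HB.instance Definition _ (V : lmodType k) (h : qpath Q -> V) :=
  GRing.isLinear.Build k kQ V _ (linext h) (linext_is_linear h).

Lemma linext_pathb (V : lmodType k) (h : qpath Q -> V) p :
  linext h (pathb p) = h p.
Proof.
by rewrite pathb.unlock (linextEw _ msuppU_le) big_seq_fset1 mcoeffUU scale1r.
Qed.

Lemma pathb_expand (x : kQ) : x = \sum_(p <- msupp x) x@_p *: pathb p.
Proof.
rewrite {1}[x]monalgE; apply: eq_bigr => p _; apply/malgP => q.
by rewrite pathb.unlock mcoeffU mcoeffZ mcoeffU mulrnAr mulr1.
Qed.

Lemma kQ_ext (V : lmodType k) (f g : {linear kQ -> V}) :
  (forall p, f (pathb p) = g (pathb p)) -> f =1 g.
Proof.
move=> e x; rewrite [x]pathb_expand !linear_sum; apply: eq_bigr => p _.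
by rewrite !linearZ e.
Qed.

Lemma kQmulE x y : kQmul x y = \sum_(p <- msupp x) x@_p *: linext (pmul p) y.
Proof. by rewrite kQmul.unlock (linextEw _ (fsubset_refl _)). Qed.

Lemma kQmul_pathb p q : kQmul (pathb p) (pathb q) = pmul p q.
Proof. by rewrite kQmul.unlock !linext_pathb. Qed.

Lemma kQmulDl : left_distributive kQmul +%R.
Proof. by move=> x y z; rewrite kQmul.unlock linearD. Qed.

Lemma kQmulDr : right_distributive kQmul +%R.
Proof.
move=> x y z; rewrite !kQmulE -big_split /=; apply: eq_bigr => p _.
by rewrite -scalerDr linearD.
Qed.

Lemma kQmulZl c x y : c *: kQmul x y = kQmul (c *: x) y.
Proof. by rewrite kQmul.unlock linearZ. Qed.

Lemma kQmulZr c x y : c *: kQmul x y = kQmul x (c *: y).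
Proof.
rewrite !kQmulE scaler_sumr; apply: eq_bigr => p _.
rewrite (linearZ_LR (linext (pmul p))) !scalerA.
by rewrite [c * _]mulrC.
Qed.

Lemma kQmull_is_linear y : linear (kQmul^~ y).
Proof. by move=> c u v; rewrite kQmulDl -kQmulZl. Qed.

Lemma kQmulr_is_linear x : linear (kQmul x).
Proof. by move=> c u v; rewrite kQmulDr -kQmulZr. Qed.

Let mulL y : {linear kQ -> kQ} :=
  HB.pack (kQmul^~ y) (GRing.isLinear.Build _ _ _ _ _ (kQmull_is_linear y)).
Let mulR x : {linear kQ -> kQ} :=
  HB.pack (kQmul x) (GRing.isLinear.Build _ _ _ _ _ (kQmulr_is_linear x)).

Lemma kQmulA : associative kQmul.
Proof.
move=> x y z.
apply: (kQ_ext (f := mulL (kQmul y z)) (g := mulL z \o mulL y)) => p /=.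
apply: (kQ_ext (f := mulR (pathb p) \o mulL z)
               (g := mulL z \o mulR (pathb p))) => q /=.
apply: (kQ_ext (f := mulR (pathb p) \o mulR (pathb q))
               (g := mulR (kQmul (pathb p) (pathb q)))) => r /=.
have k0 u : kQmul u 0 = 0 by exact: (linear0 (mulR u)).
have k0' u : kQmul 0 u = 0 by exact: (linear0 (mulL u)).
have pmulE p1 p2 : pmul p1 p2 =
  if ptgt p1 == psrc p2 then pathb (pcat p1 p2) else 0 by [].
rewrite !kQmul_pathb (pmulE p q) (pmulE q r).
case: (eqVneq (ptgt q) (psrc r)) => eqr;
  case: (eqVneq (ptgt p) (psrc q)) => epq.
- by rewrite !kQmul_pathb !pmulE psrc_pcat // ptgt_pcat // epq eqr !eqxx pcatA.
- by rewrite k0' kQmul_pathb pmulE psrc_pcat // (negPf epq).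
- by rewrite k0 kQmul_pathb pmulE ptgt_pcat // (negPf eqr).
- by rewrite k0 k0'.
Qed.

Lemma kQmul1 : left_id kQone kQmul.
Proof.
move=> x; apply: (kQ_ext (f := mulR kQone) (g := idfun)) => p /=.
rewrite -[LHS]/(mulL (pathb p) kQone) kQone.unlock linear_sum /=.
rewrite (bigD1 (psrc p)) //= big1.
  by rewrite kQmul_pathb /pmul eqxx pcat1p addr0.
by move=> i ne; rewrite kQmul_pathb /pmul (negPf ne).
Qed.

Lemma kQmulr1 : right_id kQone kQmul.
Proof.
move=> x; apply: (kQ_ext (f := mulL kQone) (g := idfun)) => p /=.
rewrite -[LHS]/(mulR (pathb p) kQone) kQone.unlock linear_sum /=.
rewrite (bigD1 (ptgt p)) //= big1.
  by rewrite kQmul_pathb /pmul eqxx pcatp1 addr0.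
by move=> i ne; rewrite kQmul_pathb /pmul eq_sym (negPf ne).
Qed.

End PathAlgebra.

Section PathAlgebraRing.
Variables (k : fieldType) (n : nat) (Q : quiver n.+1).
Local Notation kQ := (path_algebra k Q).
Local Notation pathb := (pathb k).

Lemma kQone_neq0 : kQone k Q != 0.
Proof.
apply/eqP => e.
have : mcoeff (triv_path Q ord0) (0 : kQ) = 0 by exact: mcoeff0.
rewrite -e kQone.unlock raddf_sum (bigD1 ord0) //=.
rewrite big1 => [|i ne]; rewrite pathb.unlock ?mcoeffUU ?addr0.
  by move/eqP; rewrite oner_eq0.
rewrite mcoeffU; case: eqP => // ei.
by move: ne; rewrite -[i]/(psrc (triv_path Q i)) ei eqxx.
Qed.

HB.instance Definition _ := GRing.Zmodule_isNzRing.Build kQ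
  (@kQmulA k _ Q) (@kQmul1 k _ Q) (@kQmulr1 k _ Q) (@kQmulDl k _ Q)
  (@kQmulDr k _ Q) kQone_neq0.
HB.instance Definition _ := GRing.Lmodule_isLalgebra.Build k kQ
  (@kQmulZl k _ Q).
HB.instance Definition _ := GRing.Lalgebra_isAlgebra.Build k kQ
  (@kQmulZr k _ Q).

Lemma pathbM (p q : qpath Q) :
  pathb p * pathb q = if ptgt p == psrc q then pathb (pcat p q) else 0.
Proof. exact: kQmul_pathb. Qed.

Lemma path_algebra1E : 1 = \sum_(i < n.+1) pathb (triv_path Q i).
Proof. by rewrite -[1]/(kQone k Q) kQone.unlock. Qed.

End PathAlgebraRing.

Definition in_ideal (S : nzRingType) (R : S -> Prop) (x : S) : Prop :=
  exists l : seq (S * S * S),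
    (forall t, t \in l -> R t.1.2) /\ x = \sum_(t <- l) t.1.1 * t.1.2 * t.2.

(* A is isomorphic to kQ/I, where I is the two-sided ideal generated by R. *)
Definition presented_by (k : fieldType) (n : nat) (Q : quiver n.+1)
    (R : path_algebra k Q -> Prop) (A : algType k) : Prop :=
  exists f : {lrmorphism path_algebra k Q -> A},
    (forall a, exists x, f x = a) /\ (forall x, f x = 0 <-> in_ideal R x).

Section Relations.
Variables (k : fieldType) (n : nat) (Q : quiver n.+1).

(* The cyclic sequence of arrows [c] is an oriented cycle without repeated
   vertices, and every arrow of Q between two of its vertices is one of its
   own arrows. *)
Definition full_cycle (c : seq (arrow Q)) : bool :=
  [&& cycle (fun a b => tgt a == src b) c,
      uniq [seq src a | a <- c]
    & [forall g, (src g \in [seq src a | a <- c]) ==>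
                 (tgt g \in [seq src a | a <- c]) ==> (g \in c)]].

(* [p] runs from the target to the source of [alpha], and the full subquiver on
   the vertices of the oriented cycle [alpha p] is just that cycle. *)
Definition return_path (alpha : arrow Q) (p : qpath Q) : bool :=
  (psrc p == tgt alpha) && full_cycle (alpha :: parrows p).

Definition cluster_relation (x : path_algebra k Q) : Prop :=
  exists alpha : arrow Q,
    (exists p, [/\ return_path alpha p,
                   forall q, return_path alpha q -> q = p
                 & x = pathb k p]) \/
    (exists p q, [/\ p != q, return_path alpha p, return_path alpha q,
                     forall r, return_path alpha r -> r = p \/ r = q
                   & x = pathb k p - pathb k q]).

End Relations.

(* Quivers without loops and oriented 2-cycles are encoded as skew-symmetric
   integer matrices: there are max(B i j, 0) arrows from i to j. *)
Definition quiver_of_mx (n : nat) (B : 'M[int]_n) : quiver n :=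
  @Quiver n
    {ij : 'I_n * 'I_n & 'I_(absz (Num.max (B ij.1 ij.2) 0))}
    (fun a => (tag a).1) (fun a => (tag a).2).

(* Fomin-Zelevinsky mutation at the vertex r. *)
Definition mutation (n : nat) (r : 'I_n) (B : 'M[int]_n) : 'M[int]_n :=
  \matrix_(i, j)
    if (i == r) || (j == r) then - B i j
    else B i j + Num.max (B i r) 0 * Num.max (B r j) 0
               - Num.max (- B i r) 0 * Num.max (- B r j) 0.

(*       5
         |
   0--1--2--3--4   *)
Definition E6_edges : seq (nat * nat) :=
  [:: (0, 1); (1, 2); (2, 3); (3, 4); (2, 5)]%N.

Definition E6_orientation (B : 'M[int]_6) : Prop :=
  B^T = - B /\
  forall i j : 'I_6, `|B i j| =
    (((i : nat, j : nat) \in E6_edges) || ((j : nat, i : nat) \in E6_edges))%:R.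

Definition E6_mutation_class (B : 'M[int]_6) : Prop :=
  exists (B0 : 'M[int]_6) (s : seq 'I_6),
    E6_orientation B0 /\ B = foldl (fun M r => mutation r M) B0 s.

(* The endomorphism algebras End_C(T) of the basic tilting objects T in the
   cluster category C of type E6, described by quivers with relations following
   Buan, Marsh and Reiten. *)
Definition cluster_tilted_E6 (k : fieldType) (A : algType k) : Prop :=
  exists B : 'M[int]_6, E6_mutation_class B /\
    presented_by (@cluster_relation k 5 (quiver_of_mx B)) A.

Definition projective (R : nzRingType) (P : lmodType R) : Prop :=
  forall (M N : lmodType R) (g : {linear M -> N}) (f : {linear P -> N}),
    (forall y, exists x, g x = y) ->
    exists h : {linear P -> M}, forall x, g (h x) = f x.

(* Every left ideal is projective. Left ideals are represented by left modules
   with an injective linear map to the regular module. For finite-dimensional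
   algebras this is equivalent to its right-handed version. *)
Definition hereditary (R : nzRingType) : Prop :=
  forall (L : lmodType R) (i : {linear L -> R^o}), injective i -> projective L.

Section Frobenius.
Variables (k : fieldType) (A : falgType k).
Local Notation d := (dim A).

(* A (x) A, in coordinates with respect to the basis underlying [v2r]. *)
Definition tensor_square := 'M[k]_(d, d).

Definition tens (a b : A) : tensor_square := (v2r a)^T *m v2r b.

Lemma tens_linearl b : linear (tens^~ b).
Proof. by move=> c x y; rewrite /tens linearP linearP mulmxDl -scalemxAl. Qed.

Lemma tens_linearr a : linear (tens a).
Proof. by move=> c x y; rewrite /tens linearP mulmxDr -scalemxAr. Qed.

(* [tens] is a tensor product. *)
Lemma tens_universal (V : lmodType k) (beta : A -> A -> V) :
  (forall b, linear (beta^~ b)) -> (forall a, linear (beta a)) ->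
  exists g : {linear tensor_square -> V},
    (forall a b, g (tens a b) = beta a b) /\
    (forall g' : {linear tensor_square -> V},
       (forall a b, g' (tens a b) = beta a b) -> g' =1 g).
Proof.
move=> linl linr.
pose e (i : 'I_d) : A := r2v (delta_mx 0 i).
have teE i j : tens (e i) (e j) = delta_mx i j.
  by rewrite /tens /e !r2vK trmx_delta mul_delta_mx.
have expandA a : a = \sum_i v2r a 0 i *: e i.
  rewrite -{1}[a]v2rK {1}[v2r a]row_sum_delta linear_sum.
  by apply: eq_bigr => i _; rewrite linearZ.
pose g (M : tensor_square) : V := \sum_i \sum_j M i j *: beta (e i) (e j).
have glin : linear g.
  move=> c M N; rewrite /g scaler_sumr -big_split /=; apply: eq_bigr => i _.
  rewrite scaler_sumr -big_split /=; apply: eq_bigr => j _.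
  by rewrite !mxE scalerDl scalerA.
pose G : {linear tensor_square -> V} :=
  HB.pack g (GRing.isLinear.Build _ _ _ _ _ glin).
have ext (g1 g2 : {linear tensor_square -> V}) :
    (forall i j, g1 (tens (e i) (e j)) = g2 (tens (e i) (e j))) -> g1 =1 g2.
  move=> h M; rewrite (matrix_sum_delta M) !linear_sum; apply: eq_bigr => i _.
  rewrite !linear_sum; apply: eq_bigr => j _.
  by rewrite !linearZ -teE h.
have Gt a b : G (tens a b) = beta a b.
  pose bl y : {linear A -> V} :=
    HB.pack (beta^~ y) (GRing.isLinear.Build _ _ _ _ _ (linl y)).
  pose br x : {linear A -> V} :=
    HB.pack (beta x) (GRing.isLinear.Build _ _ _ _ _ (linr x)).
  rewrite /= /g [in RHS](expandA a) -[RHS]/(bl b _) linear_sum.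
  apply: eq_bigr => i _; rewrite linearZ /= [in RHS](expandA b).
  rewrite -[beta (e i) _]/(br (e i) _) linear_sum scaler_sumr.
  apply: eq_bigr => j _; rewrite linearZ /= scalerA; congr (_ *: _).
  by rewrite /tens mxE big_ord1 mxE.
exists G; split=> // g' hg'; apply: ext => i j.
by rewrite hg' Gt.
Qed.

Definition lact (a : A) (t : tensor_square) : tensor_square :=
  (f2mx (amull a))^T *m t.

Definition ract (t : tensor_square) (b : A) : tensor_square :=
  t *m f2mx (amulr b).

Lemma v2r_lfun (f : 'End(A)) x : v2r (f x) = v2r x *m f2mx f.
Proof. by rewrite unlock /= r2vK. Qed.

Lemma lactE a x y : lact a (tens x y) = tens (a * x) y.
Proof.
by rewrite /lact /tens mulmxA -trmx_mul -v2r_lfun lfunE.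
Qed.

Lemma ractE x y b : ract (tens x y) b = tens x (y * b).
Proof. by rewrite /ract /tens -mulmxA -v2r_lfun lfunE. Qed.

(* On a (x) b, the maps (m (x) 1)(1 (x) Delta) and (1 (x) m)(Delta (x) 1) take
   the values a . Delta(b) and Delta(a) . b. *)
Definition open_frobenius (Delta : 'Hom(A, tensor_square)) : Prop :=
  forall a b, lact a (Delta b) = Delta (a * b) /\
              Delta (a * b) = ract (Delta a) b.

Definition left_defect (a b : A) (Delta : 'Hom(A, tensor_square)) :=
  lact a (Delta b) - Delta (a * b).

Definition right_defect (a b : A) (Delta : 'Hom(A, tensor_square)) :=
  ract (Delta a) b - Delta (a * b).

Lemma left_defect_is_linear a b : linear (left_defect a b).
Proof.
move=> c f g; rewrite /left_defect /lact !add_lfunE !scale_lfunE mulmxDr.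
by rewrite -scalemxAr scalerBr opprD addrACA.
Qed.
HB.instance Definition _ a b := GRing.isLinear.Build k 'Hom(A, tensor_square)
  tensor_square _ (left_defect a b) (left_defect_is_linear a b).

Lemma right_defect_is_linear a b : linear (right_defect a b).
Proof.
move=> c f g; rewrite /right_defect /ract !add_lfunE !scale_lfunE mulmxDl.
by rewrite -scalemxAl scalerBr opprD addrACA.
Qed.
HB.instance Definition _ a b := GRing.isLinear.Build k 'Hom(A, tensor_square)
  tensor_square _ (right_defect a b) (right_defect_is_linear a b).

(* The subspace of open Frobenius coproducts, see [frob_spaceP]; it suffices to
   test the bimodule equations on a basis. *)
Definition frob_space : {vspace 'Hom(A, tensor_square)} :=
  (\bigcap_(ij : 'I_(\dim {:A}) * 'I_(\dim {:A}))
     (lker (linfun (left_defect (vbasis {:A})`_ij.1 (vbasis {:A})`_ij.2)) :&: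
      lker (linfun (right_defect (vbasis {:A})`_ij.1 (vbasis {:A})`_ij.2))))%VS.

Lemma frob_spaceP (Delta : 'Hom(A, tensor_square)) :
  Delta \in frob_space <-> open_frobenius Delta.
Proof.
rewrite memvE; split=> [/subv_bigcapP h | h]; last first.
  apply/subv_bigcapP => ij _; rewrite -memvE.
  have [h1 h2] := h (vbasis {:A})`_ij.1 (vbasis {:A})`_ij.2.
  rewrite memv_cap !memv_ker !lfunE /= /left_defect /right_defect.
  by rewrite h1 -h2 subrr eqxx.
pose e := (vbasis {:A} : seq A).
have f2mxD (u v : 'End(A)) c : f2mx (c *: u + v) = c *: f2mx u + f2mx v.
  apply/row_matrixP => i; rewrite linearP /= !rowE.
  rewrite -[delta_mx 0 i]r2vK -!v2r_lfun add_lfunE scale_lfunE.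
  by rewrite linearP.
have lactD c x y t : lact (c *: x + y) t = c *: lact x t + lact y t.
  by rewrite /lact linearP f2mxD linearP /= mulmxDl -scalemxAl.
have ractD c x y t : ract t (c *: x + y) = c *: ract t x + ract t y.
  by rewrite /ract linearP f2mxD mulmxDr -scalemxAr.
have ext (V : lmodType k) (beta : A -> A -> V) :
    (forall b, linear (beta^~ b)) -> (forall a, linear (beta a)) ->
    (forall i j : 'I_(\dim {:A}), beta e`_i e`_j = 0) ->
    forall a b, beta a b = 0.
  move=> linl linr h0.
  pose bl y : {linear A -> V} :=
    HB.pack (beta^~ y) (GRing.isLinear.Build _ _ _ _ _ (linl y)).
  pose br x : {linear A -> V} :=
    HB.pack (beta x) (GRing.isLinear.Build _ _ _ _ _ (linr x)).
  have h1 (i : 'I_(\dim {:A})) b : br e`_i b = 0.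
    rewrite (coord_vbasis (memvf b)) linear_sum big1 // => j _.
    by rewrite linearZ /= h0 scaler0.
  move=> a b; rewrite -[beta a b]/(bl b a) (coord_vbasis (memvf a)).
  rewrite linear_sum big1 // => i _.
  by rewrite linearZ /= -[beta _ b]/(br e`_i b) h1 scaler0.
have hd (i j : 'I_(\dim {:A})) :
    left_defect e`_i e`_j Delta = 0 /\ right_defect e`_i e`_j Delta = 0.
  have := h (i, j) isT; rewrite -memvE.
  by rewrite memv_cap !memv_ker !lfunE => /andP[/eqP-> /eqP->].
move=> a b; split; [apply/eqP | apply/esym/eqP]; rewrite -subr_eq0; apply/eqP.
- apply: (ext _ (fun a b => left_defect a b Delta)) => [y c u v|x c u v|i j].
  + rewrite /left_defect lactD mulrDl -scalerAl linearP /=.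
    by rewrite scalerBr opprD addrACA.
  + rewrite /left_defect mulrDr -scalerAr !linearP /= /lact mulmxDr -scalemxAr.
    by rewrite scalerDr addrACA.
  + by case: (hd i j).
- apply: (ext _ (fun a b => right_defect a b Delta)) => [y c u v|x c u v|i j].
  + rewrite /right_defect mulrDl -scalerAl !linearP /= /ract mulmxDl -scalemxAl.
    by rewrite scalerDr addrACA.
  + rewrite /right_defect ractD mulrDr -scalerAr linearP /=.
    by rewrite scalerBr opprD addrACA.
  + by case: (hd i j).
Qed.

Definition Frobdim : nat := \dim frob_space.

End Frobenius.

(* Main.v *)
(** By the Fomin-Zelevinsky mutation class of E6, [A] is kQ/I for one of 67
quivers.  A nonzero [w] in A (x) A with [a w = w a] for all [a] gives the nonzero
open Frobenius coproduct [a |-> a w].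

If Q has a relation, such a [w] is found among two shapes.  Either [w = x (x) y],
where the nonzero path [x] starts where the nonzero path [y] ends, every arrow
kills [x] on the left and every arrow kills [y] on the right; or, for four of the
quivers, [w = x (x) y b + b x (x) y] for an arrow [b].  A path is nonzero in A as
soon as its class under the commutativity relations is free of zero relations:
the indicator function of the class vanishes on I.

If Q has no relation, A is a path algebra, hence hereditary: for a left ideal L,
a surjection [g : M -> N] and [phi : L -> N], choose a linear lift [S] of [phi].
Its failure to commute with the arrows extends from L to a linear map
[C a : A -> ker g] for each arrow [a], and on the free algebra A the equation
[T (a x) = a T x - C a x] is solved by recursion on paths; [S + T] is then an
A-linear lift. *)
Require Import Defs.
From HB Require Import structures.
From mathcomp Require Import all_boot all_order all_algebra all_field.
From mathcomp Require Import finmap monalg.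
From Stdlib Require Import Classical IndefiniteDescription.

Set Implicit Arguments.
Unset Strict Implicit.
Unset Printing Implicit Defensive.

Import Order.TTheory GRing.Theory Num.Theory VectorInternalTheory.
Local Open Scope ring_scope.

(** * Products of paths with vertices and arrows *)

Section PathProducts.
Variables (k : fieldType) (n : nat) (Q : quiver n.+1).
Local Notation kQ := (path_algebra k Q).

Lemma walk1 (a : arrow Q) : walk (src a) [:: a].
Proof. by rewrite /= eqxx. Qed.

Definition arrow_path (a : arrow Q) : qpath Q :=
  @QPath _ _ (src a, [:: a]) (walk1 a).

Definition vertex (i : 'I_n.+1) : kQ := pathb k (triv_path Q i).
Definition arrowb (a : arrow Q) : kQ := pathb k (arrow_path a).

Fixpoint walkb (i : 'I_n.+1) (s : seq (arrow Q)) : kQ :=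
  if s is a :: s' then arrowb a * walkb (tgt a) s' else vertex i.

Lemma pathb_walkb (p : qpath Q) : pathb k p = walkb (psrc p) (parrows p).
Proof.
case: p => -[i s]; elim: s i => [|a s IH] i Hw.
  by congr pathb; apply: val_inj.
have /andP[/eqP Ei Hs] : (src a == i) && walk (tgt a) s by [].
rewrite /= -[walkb _ s](IH _ Hs) /arrowb pathbM eqxx; congr pathb.
by apply: val_inj; rewrite pcatE //= /psrc /= Ei.
Qed.

Lemma vertexM_pathb i (p : qpath Q) :
  vertex i * pathb k p = if i == psrc p then pathb k p else 0.
Proof.
by rewrite pathbM -[ptgt _]/i; case: eqP => // ->; rewrite pcat1p.
Qed.

Lemma pathbM_vertex i (p : qpath Q) :
  pathb k p * vertex i = if ptgt p == i then pathb k p else 0.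
Proof.
by rewrite pathbM -[psrc (triv_path _ _)]/i; case: eqP => // <-; rewrite pcatp1.
Qed.

Lemma vertexM i j : vertex i * vertex j = if i == j then vertex i else 0.
Proof. by rewrite vertexM_pathb; case: eqP => // ->. Qed.

Lemma vertexM_arrow i a : vertex i * arrowb a = if i == src a then arrowb a else 0.
Proof. exact: vertexM_pathb. Qed.

Lemma arrowM_vertex i a : arrowb a * vertex i = if tgt a == i then arrowb a else 0.
Proof. exact: pathbM_vertex. Qed.

Lemma linear_eq0 (V : lmodType k) (h : kQ -> V) :
  linear h -> (forall p, h (pathb k p) = 0) -> forall x, h x = 0.
Proof.
move=> hl h0 x; pose g : {linear kQ -> V} :=
  HB.pack h (GRing.isLinear.Build _ _ _ _ _ hl).
rewrite -[h x]/(g x) [x]pathb_expand linear_sum big1 // => p _.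
by rewrite linearZ /= h0 scaler0.
Qed.

(** Every path is obtained from its end vertex by multiplying by arrows on the left, and the paths
    span. This reduces a condition on all elements to vertices and arrows. *)
Lemma path_algebra_ind (P : kQ -> Prop) :
  (forall c x y, P x -> P y -> P (c *: x + y)) -> P 0 ->
  (forall i, P (vertex i)) -> (forall a x, P x -> P (arrowb a * x)) ->
  forall x, P x.
Proof.
move=> PD P0 Pv Pa x; rewrite [x]pathb_expand.
elim: (X in \sum_(p <- X) _) => [|p s IH]; first by rewrite big_nil.
rewrite big_cons; apply: PD => //; rewrite pathb_walkb.
by elim: (parrows p) (psrc p) => [|a s' IHs] i /=; [exact: Pv | exact: Pa].
Qed.

End PathProducts.

(** * Modules over an algebra as vector spaces *)

Section RestrictScalars.
Variables (k : fieldType) (A : algType k) (M : lmodType A).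

(** A separate name for the carrier, so that the action of [k] does not clash with that of [A]; the
    latter becomes the [k]-linear map [act a]. *)
Definition restrict_scalars : Type := M.
HB.instance Definition _ := GRing.Zmodule.on restrict_scalars.

Let scale (c : k) (m : restrict_scalars) : restrict_scalars := (c%:A : A) *: (m : M).
Fact scaleA c d m : scale c (scale d m) = scale (c * d) m.
Proof. by rewrite /scale scalerA -scalerAl mul1r scalerA. Qed.
Fact scale1 : left_id 1 scale.
Proof. by move=> m; rewrite /scale !scale1r. Qed.
Fact scaleDr : right_distributive scale +%R.
Proof. by move=> c m m'; rewrite /scale scalerDr. Qed.
Fact scaleDl m : {morph scale^~ m : c d / c + d}.
Proof. by move=> c d; rewrite /scale !scalerDl. Qed.
HB.instance Definition _ :=
  GRing.Zmodule_isLmodule.Build k restrict_scalars scaleA scale1 scaleDr scaleDl.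

Definition act (a : A) (m : restrict_scalars) : restrict_scalars := a *: (m : M).

Fact act_linear a : linear (act a).
Proof.
move=> c x y; rewrite /act [LHS]scalerDr; congr (_ + _).
by rewrite -[LHS]/(a *: (c%:A *: (x : M))) scalerA -scalerAr mulr1
           -[RHS]/(c%:A *: (a *: (x : M))) scalerA -scalerAl mul1r.
Qed.
HB.instance Definition _ a :=
  GRing.isLinear.Build k restrict_scalars restrict_scalars _ (act a) (act_linear a).

Lemma actM a b m : act (a * b) m = act a (act b m).
Proof. by rewrite /act scalerA. Qed.

Lemma act_linearl m : linear (act^~ m).
Proof. by move=> c a b; rewrite /act [LHS]scalerDl -mulr_algl -scalerA. Qed.

Lemma act0 m : act 0 m = 0.
Proof. exact: (@scale0r _ M). Qed.

End RestrictScalars.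

(** A free family in the image of [i] that does not span it can be enlarged, and its size is bounded
    by the dimension of [A]. The family is kept in [L], where a map defined on [L] can be evaluated
    on it. *)
Lemma left_ideal_basis (k : fieldType) (A : falgType k) (L : lmodType A)
    (i : {linear L -> A^o}) :
  exists s : seq L, free [seq (i l : A) | l <- s] /\
    forall l, (i l : A) \in <<[seq (i l : A) | l <- s]>>%VS.
Proof.
have H m : (exists s : seq L, free [seq (i l : A) | l <- s] /\
     forall l, (i l : A) \in <<[seq (i l : A) | l <- s]>>%VS) \/
   (exists s : seq L, free [seq (i l : A) | l <- s] /\ size s = m).
  elim: m => [|m [|[s [fs ss]]]]; [|by left|].
    by right; exists [::]; rewrite /= nil_free.
  case: (classic (exists l, (i l : A) \notin <<[seq (i l : A) | l <- s]>>%VS)).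
    by case=> l hl; right; exists (l :: s); rewrite /= free_cons hl fs ss.
  move=> h; left; exists s; split=> // l.
  by apply/negPn/negP => hl; apply: h; exists l.
(* One more than the dimension, a size that no free family attains. *)
have [//|[s [fs ss]]] := H (\dim {: A}).+1.
have := dimvS (subvf <<[seq (i l : A) | l <- s]>>%VS).
by rewrite (eqP fs) size_map ss ltnn.
Qed.

(** * Path algebras are hereditary *)

Section Hereditary.
Variables (k : fieldType) (n : nat) (Q : quiver n.+1) (A : falgType k).
Variable f : {lrmorphism path_algebra k Q -> A}.
Local Notation kQ := (path_algebra k Q).

Section Twist.
Variables (M : lmodType A) (C : arrow Q -> A -> restrict_scalars M).
Hypothesis C_lin : forall a, linear (C a).
Hypothesis C_src : forall a x, act (f (vertex k Q (src a))) (C a x) = C a x.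

(** A nontrivial path has a unique first arrow, so the recursion defines the correction on a basis
    with no compatibility to check. *)
Fixpoint twist_walk (i : 'I_n.+1) (s : seq (arrow Q)) : restrict_scalars M :=
  if s is a :: s' then
    act (f (arrowb k a)) (twist_walk (tgt a) s') - C a (f (walkb k (tgt a) s'))
  else 0.

Definition twist : kQ -> restrict_scalars M :=
  linext (fun p => twist_walk (psrc p) (parrows p)).

HB.instance Definition _ :=
  GRing.Linear.copy twist (linext (fun p => twist_walk (psrc p) (parrows p))).

Lemma twist_pathb p : twist (pathb k p) = twist_walk (psrc p) (parrows p).
Proof. exact: linext_pathb. Qed.

(** Both terms of the recursion lie in the component of the source of the first arrow: the first
    because the arrow starts there, the second by [C_src]. *)
Lemma vertex_twist_walk j i s : walk i s ->
  act (f (vertex k Q j)) (twist_walk i s) = if j == i then twist_walk i s else 0.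
Proof.
case: s => [|a s] /=; first by rewrite linear0 if_same.
case/andP=> /eqP <- _; rewrite linearB /= -actM -rmorphM vertexM_arrow.
rewrite -C_src -actM -rmorphM vertexM.
by case: eqP => [->|_] //; rewrite !rmorph0 !act0 subr0.
Qed.

Lemma vertex_twist j x : act (f (vertex k Q j)) (twist x) = twist (vertex k Q j * x).
Proof.
apply/eqP; rewrite -subr_eq0; apply/eqP; move: x.
apply: linear_eq0 => [c x y | p].
  by rewrite mulrDr -scalerAr !linearP /= scalerBr scalerN addrACA.
rewrite vertexM_pathb twist_pathb vertex_twist_walk ?(valP p) //.
by case: ifP => _; [rewrite twist_pathb subrr | rewrite (linear0 twist) subrr].
Qed.

(** The vertex in the last term makes the recursion valid for all [x]: if a path [p] does not start
    at the target of [a], then [a p = 0], and [a] kills the twist of [p], which lies at another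
    vertex. *)
Lemma twist_arrow a x : twist (arrowb k a * x) =
  act (f (arrowb k a)) (twist x) - C a (f (vertex k Q (tgt a) * x)).
Proof.
apply/eqP; rewrite -subr_eq0; apply/eqP; move: x.
apply: linear_eq0 => [c x y | p].
  rewrite !mulrDr -!scalerAr !linearP /= C_lin.
  by rewrite !scalerBr !opprB opprD [X in _ + X]addrACA [LHS]addrACA.
rewrite vertexM_pathb; case: eqP => [e|ne].
  have -> : arrowb k a * pathb k p = pathb k (pcat (arrow_path a) p).
    by rewrite pathbM -[ptgt _]/(tgt a) e eqxx.
  rewrite !twist_pathb (pathb_walkb k p) /psrc /parrows pcatE //=.
  by rewrite e; apply: subrr.
have -> : arrowb k a * pathb k p = 0.
  by rewrite pathbM -[ptgt _]/(tgt a); case: eqP.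
have -> : act (f (arrowb k a)) (twist (pathb k p)) = 0.
  have := arrowM_vertex k (tgt a) a; rewrite eqxx => <-.
  rewrite rmorphM actM vertex_twist vertexM_pathb.
  by case: eqP => // _; rewrite !linear0.
have C0 : C a 0 = 0.
  by have := C_lin a (-1) 0 0; rewrite scaler0 addr0 scaleN1r addNr.
by rewrite !linear0 C0 !subr0.
Qed.
End Twist.

Lemma path_algebra_hereditary : bijective f -> hereditary A.
Proof.
case=> finv fK finvK L i i_inj M N g phi g_surj.
have finv_lin : linear finv.
  by move=> c x y; apply: (can_inj fK); rewrite linearP /= !finvK.
have [s [s_free s_span]] := left_ideal_basis i.
pose b := in_tuple [seq (i l : A) | l <- s].
pose m j : M := sval (constructive_indefinite_description _ (g_surj (phi s`_j))).
have mP j : g (m j) = phi s`_j.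
  by rewrite /m; case: constructive_indefinite_description.
(* A [k]-linear map on all of [A] that lifts [phi] on the image of [i]. *)
pose S0 (x : A) : restrict_scalars M := \sum_j coord b j x *: (m j : restrict_scalars M).
have S0_lin : linear S0.
  move=> c x y; rewrite /S0 scaler_sumr -big_split /=; apply: eq_bigr => j _.
  by rewrite linearP scalerDl scalerA.
have bE (j : 'I_(size [seq (i l : A) | l <- s])) : b`_j = i s`_j.
  by rewrite (nth_map 0) // -(size_map (fun l => i l : A)).
have iE x : x \in <<b>>%VS ->
    i (\sum_j ((coord b j x)%:A : A) *: s`_j) = x.
  move=> xb; rewrite [RHS](coord_span xb) linear_sum; apply: eq_bigr => j _.
  by rewrite linearZ bE -[LHS]/((coord b j x)%:A * (i s`_j : A)) mulr_algl.
have gS0 l : g (S0 (i l)) = phi l.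
  rewrite -[in RHS](i_inj _ _ (iE _ (s_span l))) !linear_sum.
  apply: eq_bigr => j _; rewrite [in RHS]linearZ /= -mP.
  exact: (linearZ_LR g).
pose e j := f (vertex k Q j).
have eM j1 j2 : e j1 * e j2 = if j1 == j2 then e j1 else 0.
  by rewrite /e -rmorphM vertexM; case: ifP; rewrite ?rmorph0.
have e1 : \sum_j e j = 1 by rewrite -(rmorph1 f) path_algebra1E rmorph_sum.
(* Summing over the orthogonal idempotents [e j] turns [S0] into a lift that commutes with the
   vertices. *)
pose S (x : A) : restrict_scalars M := \sum_j act (e j) (S0 (e j * x)).
have S_lin : linear S.
  move=> c x y; rewrite /S scaler_sumr -big_split /=; apply: eq_bigr => j _.
  by rewrite mulrDr -scalerAr S0_lin linearP.
have S00 : S0 0 = 0 by rewrite /S0 big1 // => j _; rewrite linear0 scale0r.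
have gact x m0 : g (act x m0) = x *: g m0 by exact: (linearZ_LR g).
have gS l : g (S (i l)) = phi l.
  rewrite /S (linear_sum g) -[in RHS](scale1r l) -e1 scaler_suml linear_sum.
  apply: eq_bigr => j _ /=; rewrite gact.
  have -> : e j * i l = i (e j *: l) by rewrite linearZ.
  by rewrite gS0 -linearZ scalerA eM eqxx.
have eS j x : act (e j) (S x) = S (e j * x).
  rewrite /S linear_sum; apply: eq_bigr => j' _ /=.
  rewrite -actM mulrA !eM eq_sym; case: eqP => [->//|_].
  by rewrite mul0r act0 S00 linear0.
(* Projecting onto the image of [i] extends to all of [A] the failure of [S] to commute with an
   arrow. *)
pose rho := projv <<b>>%VS.
have rhoK l : rho (i l) = i l by rewrite projv_id ?s_span.
pose C a (x : A) := S (f (arrowb k a) * rho x) - act (f (arrowb k a)) (S (rho x)).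
have C_lin a : linear (C a).
  move=> c x y; rewrite /C !linearP /= mulrDr -scalerAr !S_lin linearP /=.
  by rewrite opprD addrACA scalerBr.
have C_src a x : act (f (vertex k Q (src a))) (C a x) = C a x.
  by rewrite /C linearB /= eS mulrA -actM -rmorphM vertexM_arrow eqxx.
(* On the image of [i] the composite of [g] and [S] is the [A]-linear map [phi], so the failure lies
   in the kernel of [g]. *)
have gC a x : g (C a x) = 0.
  have [l El] : exists l, i l = rho x by eexists; apply: iE (memv_proj _ _).
  rewrite /C -El (linearB g) gact gS.
  have -> : f (arrowb k a) * i l = i (f (arrowb k a) *: l) by rewrite linearZ.
  by rewrite gS linearZ subrr.
pose T := twist C.
have T_lin : linear T by exact: linearP.
have gT x : g (T x) = 0.
  elim/path_algebra_ind: x => [c x y gx gy||j|a x gx].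
  - by rewrite /T linearP (linearD g) (linearZ_LR g) gx gy scaler0 addr0.
  - by rewrite /T !linear0.
  - by rewrite /T twist_pathb linear0.
  - by rewrite /T twist_arrow // (linearB g) gC gact gx scaler0 subr0.
pose h (x : A) : restrict_scalars M := S x + T (finv x).
have h_lin : linear h.
  by move=> c x y; rewrite /h S_lin finv_lin T_lin scalerDr addrACA.
have h0 : h 0 = 0.
  by have := h_lin (-1) 0 0; rewrite scaler0 addr0 scaleN1r addNr.
have iM x l : i (x *: l) = x * i l by rewrite linearZ.
have finvM x y : finv (f x * y) = x * finv y.
  by apply: (can_inj fK); rewrite finvK rmorphM /= finvK.
(* On the image of [i], where [rho] is the identity, the defect of [S] cancels the term [C a]
   subtracted by [T]. *)
have h_arrow a l : h (f (arrowb k a) * i l) = act (f (arrowb k a)) (h (i l)).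
  rewrite /h finvM {1}/T twist_arrow // rmorphM /= finvK.
  rewrite -[f (vertex _ _ _) * i l]iM /C rhoK iM -eS -actM mulrA.
  have := arrowM_vertex k (tgt a) a; rewrite eqxx => e_arrow.
  rewrite -rmorphM e_arrow [in RHS]linearD /=.
  by rewrite opprB addrC -!addrA addNr addr0 addrC.
have h_vertex j l : h (e j * i l) = act (e j) (h (i l)).
  by rewrite /h finvM linearD /= eS /T vertex_twist.
have h_act x l : h (f x * i l) = act (f x) (h (i l)).
  elim/path_algebra_ind: x l => [c x y hx hy l|l|j l|a x hx l].
  - rewrite linearP mulrDl -scalerAl h_lin hx hy.
    by rewrite (act_linearl _ c).
  - by rewrite linear0 mul0r act0 h0.
  - exact: h_vertex.
  - by rewrite rmorphM /= -mulrA -iM h_arrow iM hx actM.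
have hl_lin : linear (fun l => h (i l) : M).
  move=> a l l'; rewrite linearD linearZ -(finvK a).
  have := h_lin 1 (f (finv a) * i l) (i l').
  by rewrite !scale1r h_act.
pose hl : {linear L -> M} :=
  HB.pack (fun l => h (i l) : M) (GRing.isLinear.Build _ _ _ _ _ hl_lin).
by exists hl => l; rewrite /= /h (linearD g) gS gT addr0.
Qed.
End Hereditary.

(** An arbitrary set-theoretic section of [f] suffices: [g] is constant on the fibres of [f], which
    makes the composite linear. *)
Lemma linear_factor (k : fieldType) (U V W : lmodType k) (f : {linear U -> V})
    (g : {linear U -> W}) :
  (forall y, exists x, f x = y) -> (forall x, f x = 0 -> g x = 0) ->
  exists h : {linear V -> W}, forall x, h (f x) = g x.
Proof.
move=> f_surj ker.
pose s y := sval (constructive_indefinite_description _ (f_surj y)).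
have sK y : f (s y) = y by rewrite /s; case: constructive_indefinite_description.
have gE x y : f x = f y -> g x = g y.
  by move=> e; apply/eqP; rewrite -subr_eq0 -linearB ker // linearB e subrr.
have h_lin : linear (g \o s).
  by move=> c x y /=; rewrite -linearP; apply: gE; rewrite linearP !sK.
pose h : {linear V -> W} := HB.pack (g \o s) (GRing.isLinear.Build _ _ _ _ _ h_lin).
by exists h => x; apply: gE; rewrite sK.
Qed.

(** * Casimir elements and open Frobenius coproducts *)

Section CasimirElements.
Variables (k : fieldType) (A : falgType k).
Local Notation AA := (tensor_square A).

(** The order is reversed because matrices act on row vectors. *)
Lemma amullM (a b : A) : f2mx (amull (a * b)) = f2mx (amull b) *m f2mx (amull a).
Proof.
apply/row_matrixP => i; rewrite !rowE mulmxA -[delta_mx 0 i]r2vK.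
by rewrite -!v2r_lfun !lfunE /= mulrA.
Qed.

Lemma amulrM (a b : A) : f2mx (amulr (a * b)) = f2mx (amulr a) *m f2mx (amulr b).
Proof.
apply/row_matrixP => i; rewrite !rowE mulmxA -[delta_mx 0 i]r2vK.
by rewrite -!v2r_lfun !lfunE /= mulrA.
Qed.

Lemma amullP (c : k) (a b : A) :
  f2mx (amull (c *: a + b)) = c *: f2mx (amull a) + f2mx (amull b).
Proof.
apply/row_matrixP => i; rewrite [in RHS]linearP /= !rowE -[delta_mx 0 i]r2vK.
by rewrite -!v2r_lfun !lfunE /= mulrDl -scalerAl linearP.
Qed.

Lemma amulrP (c : k) (a b : A) :
  f2mx (amulr (c *: a + b)) = c *: f2mx (amulr a) + f2mx (amulr b).
Proof.
apply/row_matrixP => i; rewrite [in RHS]linearP /= !rowE -[delta_mx 0 i]r2vK.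
by rewrite -!v2r_lfun !lfunE /= mulrDr -scalerAr linearP.
Qed.

Lemma lactM a b (t : AA) : lact (a * b) t = lact a (lact b t).
Proof. by rewrite /lact amullM trmx_mul mulmxA. Qed.

Lemma ractM a b (t : AA) : ract t (a * b) = ract (ract t a) b.
Proof. by rewrite /ract amulrM mulmxA. Qed.

Lemma lact_ract a b (t : AA) : lact a (ract t b) = ract (lact a t) b.
Proof. by rewrite /lact /ract mulmxA. Qed.

Lemma lactP (t : AA) : linear (@lact k A ^~ t).
Proof. by move=> c a b; rewrite /lact amullP linearP /= mulmxDl -scalemxAl. Qed.

Lemma ractP (t : AA) : linear (@ract k A t).
Proof. by move=> c a b; rewrite /ract amulrP mulmxDr -scalemxAr. Qed.

Lemma lact0 (t : AA) : lact 0 t = 0.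
Proof. by have := lactP t (-1) 0 0; rewrite scaler0 addr0 scaleN1r addNr. Qed.

Lemma ract0 (t : AA) : ract t 0 = 0.
Proof. by have := ractP t (-1) 0 0; rewrite scaler0 addr0 scaleN1r addNr. Qed.

Lemma tens0l (b : A) : tens 0 b = 0.
Proof. by rewrite /tens linear0 trmx0 mul0mx. Qed.

Lemma tens0r (a : A) : tens a 0 = 0.
Proof. by rewrite /tens linear0 mulmx0. Qed.

Lemma lact_sum (I : Type) (r : seq I) a (F : I -> AA) :
  lact a (\sum_(i <- r) F i) = \sum_(i <- r) lact a (F i).
Proof. by rewrite /lact mulmx_sumr. Qed.

Lemma ract_sum (I : Type) (r : seq I) a (F : I -> AA) :
  ract (\sum_(i <- r) F i) a = \sum_(i <- r) ract (F i) a.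
Proof. by rewrite /ract mulmx_suml. Qed.

(** The coproduct is [a |-> a t]: it is left linear by associativity, right linear since [t]
    commutes with [A], and nonzero since its value at 1 is [t]. *)
Lemma Frobdim_gt0 (t : AA) :
  t != 0 -> (forall a, lact a t = ract t a) -> (0 < Frobdim A)%N.
Proof.
move=> t0 tC; pose L : {linear A -> AA} :=
  HB.pack (@lact k A ^~ t) (GRing.isLinear.Build _ _ _ _ _ (lactP t)).
pose D : 'Hom(A, AA) := linfun L.
have lact1 : lact 1 t = t.
  have E : f2mx (amull (1 : A)) = 1%:M.
    apply/row_matrixP => i; rewrite !rowE -[delta_mx 0 i]r2vK.
    by rewrite -!v2r_lfun !lfunE /= mul1r mulmx1.
  by rewrite /lact E trmx1 mul1mx.
rewrite lt0n dimv_eq0; apply/negP => /eqP E.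
have : D \in frob_space A.
  apply/frob_spaceP => a b; rewrite !lfunE /=; split; first by rewrite lactM.
  by rewrite tC ractM -tC.
rewrite E memv0 => /eqP D0; case/eqP: t0.
by rewrite -lact1 -[lact 1 t](lfunE L) -/D D0 zero_lfunE.
Qed.

End CasimirElements.

(** * Paths and relations as words of vertices *)

Section Words.
Local Open Scope nat_scope.
Variables (m : nat) (adj : rel nat).

(* A path is encoded by the nonempty sequence of the vertices it visits.  All the
   quivers below have simple arrows, so nothing is lost. *)
Fixpoint words_from (d u : nat) : seq (seq nat) :=
  if d is d'.+1 then
    [:: u] :: flatten [seq [seq u :: w | w <- words_from d' v] |
                       v <- iota 0 m & adj u v]
  else [::].

(* [c] is the word of a path closing an arrow out of [u] to an induced cycle; [s]
   lists the sources of the arrows of that cycle and [c] their targets. *)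
Definition return_word (u : nat) (c : seq nat) : bool :=
  if c is v :: c' then
    let s := u :: belast v c' in
    [&& last v c' == u, uniq s
      & allrel (fun x y => adj x y ==> ((x, y) \in zip s c)) s s]
  else false.

(** Words with at most [m] vertices suffice, since the vertices of an induced cycle are distinct. *)
Definition return_words (u v : nat) : seq (seq nat) :=
  [seq c <- words_from m v | return_word u c].

Definition arrow_words : seq (nat * nat) :=
  [seq uv <- [seq (u, v) | u <- iota 0 m, v <- iota 0 m] | adj uv.1 uv.2].

Definition zero_words : seq (seq nat) :=
  flatten [seq let cs := return_words uv.1 uv.2 in
               [seq c <- cs | all (pred1 c) cs] | uv <- arrow_words].

Definition comm_words : seq (seq nat * seq nat) :=
  flatten [seq let cs := return_words uv.1 uv.2 in
               [seq cd <- [seq (c, d) | c <- cs, d <- cs] |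
                 (cd.1 != cd.2) && all (mem [:: cd.1; cd.2]) cs]
          | uv <- arrow_words].

Lemma return_wordE u v c s : s = u :: belast v c ->
  return_word u (v :: c) =
  [&& last v c == u, uniq s
    & allrel (fun x y => adj x y ==> ((x, y) \in zip s (v :: c))) s s].
Proof. by move->. Qed.

Lemma words_fromP d u c : u < m -> c \in words_from d u ->
  exists w, [/\ c = u :: w, path adj u w & all (gtn m) c].
Proof.
elim: d u c => [//|d IH] u c um /=; rewrite inE => /orP[/eqP ->|].
  by exists [::]; rewrite /= um.
case/flatten_mapP=> v; rewrite mem_filter mem_iota => /andP[uv /andP[_ vm]].
case/mapP=> w /(IH v _ vm) [w' [-> pw wm]] ->; exists (v :: w').
by rewrite /= uv pw um.
Qed.

Lemma mem_words_from d u w : path adj u w -> all (gtn m) w -> size w < d ->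
  u :: w \in words_from d u.
Proof.
elim: d u w => [//|d IH] u [|v w] /=; first by rewrite inE eqxx.
case/andP=> uv pw /andP[vm wm] sw; rewrite inE; apply/orP; right.
apply/flatten_mapP; exists v; first by rewrite mem_filter uv mem_iota.
by apply: map_f; apply: IH.
Qed.

Lemma arrow_wordsP u v :
  ((u, v) \in arrow_words) = [&& u < m, v < m & adj u v].
Proof.
rewrite mem_filter /=; apply/idP/idP.
  case/andP=> uv /allpairsP [[x y]] /=; rewrite !mem_iota /= => -[xm ym [eu ev]].
  by rewrite eu ev xm ym -eu -ev.
case/and3P=> um vm ->; apply/allpairsP; exists (u, v).
by rewrite !mem_iota um vm.
Qed.

Lemma zero_wordsP c : c \in zero_words ->
  exists u v, [/\ (u, v) \in arrow_words, c \in return_words u v &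
                  forall d, d \in return_words u v -> d = c].
Proof.
case/flatten_mapP=> -[u v] uv; rewrite mem_filter => /andP[/allP h cin].
by exists u, v; split=> // d /h /eqP.
Qed.

Lemma mem_zero_words u v c :
  (u, v) \in arrow_words -> c \in return_words u v ->
  (forall d, d \in return_words u v -> d = c) -> c \in zero_words.
Proof.
move=> uv cin h; apply/flatten_mapP; exists (u, v) => //.
by rewrite mem_filter cin andbT; apply/allP => d /h ->; rewrite /= eqxx.
Qed.

Lemma comm_wordsP c d : (c, d) \in comm_words ->
  exists u v, [/\ (u, v) \in arrow_words, c != d,
                  c \in return_words u v, d \in return_words u v &
                  forall e, e \in return_words u v -> e = c \/ e = d].
Proof.
case/flatten_mapP=> -[u v] uv; rewrite mem_filter => /andP[/andP[cd /allP h]].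
case/allpairsP=> -[c' d'] /= [cin din [ec ed]].
subst c' d'; exists u, v; split=> // e /h.
by rewrite !inE => /orP[] /eqP ->; [left|right].
Qed.

Lemma mem_comm_words u v c d :
  (u, v) \in arrow_words -> c != d ->
  c \in return_words u v -> d \in return_words u v ->
  (forall e, e \in return_words u v -> e = c \/ e = d) ->
  (c, d) \in comm_words.
Proof.
move=> uv cd cin din h; apply/flatten_mapP; exists (u, v) => //.
rewrite mem_filter cd /=; apply/andP; split; last first.
  by apply/allpairsP; exists (c, d).
by apply/allP => e /h [] ->; rewrite !inE eqxx ?orbT.
Qed.

Lemma comm_wordsC c d : (c, d) \in comm_words -> (d, c) \in comm_words.
Proof.
case/comm_wordsP=> u [v [uv cd cin din h]].
apply: (mem_comm_words uv) => //; first by rewrite eq_sym.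
by move=> e /h []; [right|left].
Qed.

End Words.

(** * Classes of words under the commutativity relations *)

Section WordClasses.
Local Open Scope nat_scope.
Variables (zs : seq (seq nat)) (cs : seq (seq nat * seq nat)).

Definition swaps (w : seq nat) : seq (seq nat) :=
  flatten [seq [seq take t w ++ r.2 ++ drop (size r.1) (drop t w) |
                t <- iota 0 (size w) & prefix r.1 (drop t w)] | r <- cs].

(* Three rounds exhaust the classes of all the quivers met below; for a larger
   class the list is incomplete and [indicator_class] rejects it. *)
Definition word_class (w : seq nat) : seq (seq nat) :=
  iter 3 (fun s => undup (s ++ flatten [seq swaps w' | w' <- s])) [:: w].

Definition has_zero (w : seq nat) : bool := has (fun z => infix z w) zs.

(** A sufficient condition for a path to vanish in the quotient: modulo commutativity it contains a
    zero relation. *)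
Definition null (w : seq nat) : bool := has has_zero (word_class w).

Definition indicator_class (s : seq (seq nat)) : bool :=
  all (fun w => ~~ has_zero w && all (mem s) (swaps w)) s.

Definition live (t : seq nat * seq nat) : bool := ~~ null t.1 && ~~ null t.2.

(* A list of pairs of words stands for the sum of the tensors [x (x) y].  The next
   two lists are its products with the arrow [uv] on the left and on the right. *)
Definition extend_left (om : seq (seq nat * seq nat)) (uv : nat * nat) :=
  [seq (uv.1 :: t.1, t.2) | t <- om & head 0 t.1 == uv.2].

Definition extend_right (om : seq (seq nat * seq nat)) (uv : nat * nat) :=
  [seq (t.1, rcons t.2 uv.2) | t <- om & last 0 t.2 == uv.1].

Definition same_class (t t' : seq nat * seq nat) : bool :=
  (t'.1 \in word_class t.1) && (t'.2 \in word_class t.2).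

(** A sufficient condition for two sums of tensors to agree: their summands match up to order and
    commutativity. *)
Definition balanced (om om' : seq (seq nat * seq nat)) : bool :=
  has (fun om'' => all2 same_class om om'') (permutations om').

(** The tensor product of the indicators of two classes takes the counted number as its value on the
    sum; the value 1 is nonzero in every characteristic. *)
Definition nonzero_words (om : seq (seq nat * seq nat)) : bool :=
  has (fun t => let s1 := word_class t.1 in let s2 := word_class t.2 in
    [&& indicator_class s1, indicator_class s2
      & count (fun t => (t.1 \in s1) && (t.2 \in s2)) om == 1]) om.

Lemma swapsP w w' : w' \in swaps w ->
  exists s t r, [/\ r \in cs, w = s ++ r.1 ++ t & w' = s ++ r.2 ++ t].
Proof.
case/flatten_mapP=> r rin /mapP [t]; rewrite mem_filter => /andP[h _] ->.
exists (take t w), (drop (size r.1) (drop t w)), r; split=> //.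
case/prefixP: h => x ex; rewrite ex drop_size_cat // -ex cat_take_drop.
by [].
Qed.

Lemma mem_swaps s t r : r \in cs -> r.1 != [::] ->
  s ++ r.2 ++ t \in swaps (s ++ r.1 ++ t).
Proof.
move=> rin r0; apply/flatten_mapP; exists r => //; apply/mapP; exists (size s).
  rewrite mem_filter drop_size_cat // prefix_prefix mem_iota /= !size_cat.
  by case: (r.1) r0 => //= x y _; rewrite addSn addnS ltnS leq_addr.
by rewrite take_size_cat // !drop_size_cat.
Qed.

End WordClasses.

(** * Checkable certificates for Casimir elements *)

Section CasimirWords.
Local Open Scope nat_scope.
Variables (m : nat) (adj : rel nat).

(** The last condition makes the tensor commute with the vertices; the others say that both words
    are paths. *)
Definition word_pair (t : seq nat * seq nat) : bool :=
  [&& t.1 != [::], t.2 != [::], sorted adj t.1, sorted adj t.2,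
      all (gtn m) t.1, all (gtn m) t.2 & head 0 t.1 == last 0 t.2].

(** The middle condition is commutation with each arrow; tensors with a vanishing factor are
    discarded before the two sides are matched. *)
Definition casimir_words (om : seq (seq nat * seq nat)) : bool :=
  let zs := zero_words m adj in let cs := comm_words m adj in
  [&& all word_pair om,
      all (fun uv => balanced cs (filter (live zs cs) (extend_left om uv))
                                 (filter (live zs cs) (extend_right om uv)))
          (arrow_words m adj)
    & nonzero_words zs cs om].

End CasimirWords.

(** The bridge from an abstract quiver to a relation on numbers, on which the combinatorics can be
    evaluated. *)
Record labelled_by (n : nat) (Q : quiver n) (adj : rel nat) (lab : 'I_n -> nat) :
    Prop := LabelledBy {
  labelled_lt : forall i, (lab i < n)%N;
  labelled_inj : injective lab;
  labelled_adj : forall a : arrow Q, adj (lab (src a)) (lab (tgt a));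
  labelled_arrow : forall i j, adj (lab i) (lab j) ->
    exists a : arrow Q, src a = i /\ tgt a = j;
  labelled_simple : forall a b : arrow Q, src a = src b -> tgt a = tgt b -> a = b }.

(** * Translation between paths and words *)

Section LabelledQuiver.
Local Open Scope nat_scope.
Variables (n : nat) (Q : quiver n.+1) (adj : rel nat) (lab : 'I_n.+1 -> nat).
Hypothesis hQ : labelled_by Q adj lab.
Let lab_lt := labelled_lt hQ.
Let lab_inj := labelled_inj hQ.
Let adj_arrow := labelled_adj hQ.
Let arrow_adj := labelled_arrow hQ.
Let arrow_inj := labelled_simple hQ.

Local Notation zs := (zero_words n.+1 adj).
Local Notation cs := (comm_words n.+1 adj).
Local Notation slab := (fun a : arrow Q => lab (src a)).
Local Notation tlab := (fun a : arrow Q => lab (tgt a)).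

Lemma lab_onto u : u < n.+1 -> exists i, lab i = u.
Proof.
move=> um; pose g i := Ordinal (lab_lt i).
have g_inj : injective g by move=> i j /(congr1 val) /lab_inj.
exists (invF g_inj (Ordinal um)).
exact: (congr1 val (f_invF g_inj (Ordinal um))).
Qed.

Definition code (p : qpath Q) : seq nat :=
  lab (psrc p) :: [seq tlab a | a <- parrows p].

Lemma walk_adj i s : walk i s -> path adj (lab i) (map tlab s).
Proof.
by elim: s i => //= a s IH i /andP[/eqP <- /IH ->]; rewrite adj_arrow.
Qed.

Lemma last_walk i s : last (lab i) (map tlab s) = lab (walk_end i s).
Proof. by elim: s i => /=. Qed.

Lemma walk_sources i s : walk i s -> map slab s = belast (lab i) (map tlab s).
Proof. by elim: s i => //= a s IH i /andP[/eqP <- /IH ->]. Qed.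

(** Without parallel arrows, the successive vertices determine the arrows. *)
Lemma walk_inj i s s' : walk i s -> walk i s' -> map tlab s = map tlab s' ->
  s = s'.
Proof.
elim: s s' i => [|a s IH] [|a' s'] i //= /andP[/eqP ea ws] /andP[/eqP ea' ws'].
case=> /lab_inj et e; have eaa : a = a' by apply: arrow_inj; rewrite ?ea.
by rewrite eaa in ws *; rewrite (IH s' (tgt a')).
Qed.

Lemma code_inj : injective code.
Proof.
case=> -[i s] ws [[i' s'] ws'] [] /lab_inj; rewrite /psrc /= => ei.
case: _ / ei ws' => ws' e; apply: val_inj => /=.
by congr (_, _); apply: walk_inj ws ws' e.
Qed.

Lemma code_path p : path adj (lab (psrc p)) (behead (code p)).
Proof. exact: walk_adj (valP p). Qed.

Lemma code_lt p : all (gtn n.+1) (code p).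
Proof.
apply/allP => u; rewrite inE => /orP[/eqP -> |/mapP[a _ ->]]; exact: lab_lt.
Qed.

Lemma last_code p x : last x (code p) = lab (ptgt p).
Proof. exact: last_walk. Qed.

Lemma codeP u w : path adj u w -> all (gtn n.+1) (u :: w) ->
  exists p, code p = u :: w.
Proof.
move=> puw /= /andP[/lab_onto [i ei] wm].
suff [s [ws es]] : exists s, walk i s /\ map tlab s = w.
  by exists (@QPath _ _ (i, s) ws); rewrite /code /psrc /parrows /= ei es.
elim: w u i ei puw wm => [|v w IH] u i ei /=; first by exists [::].
case/andP=> uv pvw /andP[/lab_onto [j ej] wm].
have [s [ws es]] := IH v j ej pvw wm.
have [a [ea1 ea2]] : exists a : arrow Q, src a = i /\ tgt a = j.
  by apply: arrow_adj; rewrite ei ej.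
by exists (a :: s); rewrite /= ea1 eqxx ea2 ws es ej.
Qed.

Lemma code_pcat p q : ptgt p = psrc q -> code (pcat p q) = code p ++ behead (code q).
Proof.
by move=> e; rewrite /code /psrc /parrows pcatE //= map_cat.
Qed.

Lemma full_cycle_word (a : arrow Q) p : psrc p = tgt a ->
  full_cycle (a :: parrows p) = return_word adj (lab (src a)) (code p).
Proof.
case: p => -[i s] ws; rewrite -[psrc _]/i -[parrows _]/s => ei; subst i.
have ws' : walk (tgt a) s := ws; have es := walk_sources ws'.
rewrite /full_cycle; set S := [seq src b | b <- a :: s].
have ES : lab (src a) :: belast (lab (tgt a)) [seq tlab b | b <- s] = map lab S.
  by rewrite /S /= -es -map_comp.
have SE : S = [seq src b | b <- a :: s] by [].
clearbody S; rewrite -[code _]/(lab (tgt a) :: [seq lab (tgt b) | b <- s]).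
rewrite (return_wordE _ (esym ES)) /cycle.
(* Consecutive arrows of a path fit together, so only the closing of the cycle at the source of [a]
   remains. *)
have -> : path (fun a0 b : arrow Q => tgt a0 == src b) a (rcons s a) =
          (walk_end (tgt a) s == src a).
  have E c d s' : path (fun a0 b : arrow Q => tgt a0 == src b) c (rcons s' d) =
    walk (tgt c) s' && (walk_end (tgt c) s' == src d).
    by elim: s' c => [|b s' IH] c /=; rewrite ?andbT // IH eq_sym andbA.
  by rewrite E ws'.
rewrite last_walk (inj_eq lab_inj); congr (_ && _).
rewrite (map_inj_uniq lab_inj); congr (_ && _).
(* The zipped list consists of the endpoints of the arrows of the cycle, so membership in it
   expresses that a pair is not a chord. *)
have -> : zip (map lab S) (lab (tgt a) :: map tlab s) =
          map (fun b => (slab b, tlab b)) (a :: s).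
  by rewrite SE -[_ :: map _ s]/(map tlab (a :: s)); elim: (a :: s) => //= b s' ->.
apply/forallP/allrelP => [h _ _ /mapP[i ii ->] /mapP[j jj ->] | h g].
  apply/implyP => /arrow_adj [g [eg1 eg2]].
  have := h g; rewrite eg1 eg2 ii jj /= => hg.
  by have := map_f (fun b => (slab b, tlab b)) hg; rewrite eg1 eg2.
apply/implyP => gs; apply/implyP => gt.
have := h _ _ (map_f lab gs) (map_f lab gt); rewrite adj_arrow implyTb.
case/mapP=> b bin [/lab_inj e1 /lab_inj e2].
by rewrite (arrow_inj e1 e2).
Qed.

Lemma return_words_code (a : arrow Q) c :
  c \in return_words n.+1 adj (lab (src a)) (lab (tgt a)) <->
  exists2 p, return_path a p & c = code p.
Proof.
split=> [|[p]].
  rewrite mem_filter => /andP[rc /(words_fromP (lab_lt _)) [w [ec pw wm]]].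
  have [p ep] : exists p, code p = c by rewrite ec; apply: codeP; rewrite -?ec.
  have ei : psrc p = tgt a.
    by apply: lab_inj; move: ep; rewrite ec => -[].
  by exists p; rewrite // /return_path ei eqxx full_cycle_word ?ep.
case/andP=> /eqP ei fc ->; rewrite mem_filter -full_cycle_word // fc andTb -ei.
apply: (@mem_words_from _ _ _ _ (behead (code p))); first exact: code_path.
  by case/andP: (code_lt p).
move: fc; rewrite full_cycle_word // (return_wordE _ erefl) => /and3P[_ us _].
have := uniq_leq_size us (s2 := iota 0 n.+1).
rewrite size_iota -[size (_ :: _)]/(size _).+1 size_belast; apply=> x.
rewrite mem_iota add0n inE => /orP[/eqP ->|]; first exact: lab_lt.
by move/mem_belast => xp; apply: (allP (code_lt p)).
Qed.

Lemma arrow_words_arrow u v :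
  (u, v) \in arrow_words n.+1 adj <->
  exists2 a : arrow Q, u = lab (src a) & v = lab (tgt a).
Proof.
rewrite arrow_wordsP; split=> [/and3P[um vm uv]|[a -> ->]].
  have [i ei] := lab_onto um; have [j ej] := lab_onto vm.
  have [a [ea1 ea2]] : exists a : arrow Q, src a = i /\ tgt a = j.
    by apply: arrow_adj; rewrite ei ej.
  by exists a; rewrite ?ea1 ?ea2.
by rewrite !lab_lt adj_arrow.
Qed.

Lemma cluster_relation_words (k : fieldType) (x : path_algebra k Q) :
  cluster_relation x <->
  (exists2 p, code p \in zs & x = pathb k p) \/
  (exists p q, [/\ (code p, code q) \in cs
                 & x = (pathb k p - pathb k q)%R]).
Proof.
split=> [[a [[p [rp up ->]]|[p [q [pq rp rq upq ->]]]]] |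
         [[p cp ->]|[p [q [cpq ->]]]]].
- left; exists p => //; apply: (@mem_zero_words _ _ (lab (src a)) (lab (tgt a))).
  + by apply/arrow_words_arrow; exists a.
  + by apply/return_words_code; exists p.
  + by move=> d /return_words_code [q /up -> ->].
- right; exists p, q; split=> //.
  apply: (@mem_comm_words _ _ (lab (src a)) (lab (tgt a))).
  + by apply/arrow_words_arrow; exists a.
  + by rewrite (inj_eq code_inj).
  + by apply/return_words_code; exists p.
  + by apply/return_words_code; exists q.
  + by move=> d /return_words_code [r /upq [] -> ->]; [left|right].
- have [u [v [/arrow_words_arrow [a -> ->] /return_words_code [p' rp' ec] h]]] :=
    zero_wordsP cp.
  exists a; left; exists p; split=> //; first by rewrite (code_inj ec).
  by move=> q rq; apply: code_inj; apply: h; apply/return_words_code; exists q.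
- have [u [v [/arrow_words_arrow [a -> ->] pq /return_words_code [p' rp' ec]
    /return_words_code [q' rq' eq] h]]] := comm_wordsP cpq.
  exists a; right; exists p, q; split=> //.
  + by apply: contraNneq pq => ->.
  + by rewrite (code_inj ec).
  + by rewrite (code_inj eq).
  + move=> r rr.
    have /h [] : code r \in return_words n.+1 adj (lab (src a)) (lab (tgt a)).
      by apply/return_words_code; exists r.
    * by left; apply: code_inj.
    * by right; apply: code_inj.
Qed.

(** Both paths run from the target to the source of one arrow; being parallel, they can replace each
    other inside a longer path. *)
Lemma comm_words_code c d : (c, d) \in cs ->
  exists p q, [/\ code p = c, code q = d, psrc p = psrc q & ptgt p = ptgt q].
Proof.
case/comm_wordsP=> u [v [/arrow_words_arrow [a -> ->] _]].
case/return_words_code=> p rp -> /return_words_code [q rq ->] _.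
have ends r : return_path a r -> psrc r = tgt a /\ ptgt r = src a.
  case/andP=> /eqP er; rewrite full_cycle_word // (return_wordE _ erefl).
  case/and3P=> /eqP el _ _; split=> //; apply: lab_inj.
  by rewrite -el -(last_code r 0).
have [ps pt] := ends p rp; have [qs qt] := ends q rq.
by exists p, q; rewrite ps qs pt qt.
Qed.

Lemma zero_words_code c : c \in zs -> exists p, code p = c.
Proof.
case/zero_wordsP=> u [v [/arrow_words_arrow [a -> ->]]].
by case/return_words_code=> p _ -> _; exists p.
Qed.

Lemma code_sorted p : sorted adj (code p).
Proof. exact: code_path. Qed.

Lemma sorted_codeP w : w != [::] -> sorted adj w -> all (gtn n.+1) w ->
  exists p, code p = w.
Proof. by case: w => // u w _; apply: codeP. Qed.

(** Words list vertices, so the endpoints of [q] are shared: they reappear as the last vertex of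
    [p1] and the first of [p2]. *)
Lemma code_infix p q s t : code p = s ++ code q ++ t ->
  exists p1 p2, [/\ ptgt p1 = psrc q, ptgt q = psrc p2,
    code p1 = rcons s (lab (psrc q)), code p2 = lab (ptgt q) :: t
    & p = pcat p1 (pcat q p2)].
Proof.
move=> e; have := code_sorted p; have := code_lt p; rewrite e.
have e1 : s ++ code q ++ t = rcons s (lab (psrc q)) ++ behead (code q) ++ t.
  by rewrite cat_rcons.
have e2 : s ++ code q ++ t =
    (s ++ belast (lab (psrc q)) (behead (code q))) ++ lab (ptgt q) :: t.
  by rewrite -(last_code q 0) {1}/code lastI cat_rcons catA.
move=> l_all l_sort.
have [p1 ep1] : exists p1, code p1 = rcons s (lab (psrc q)).
  apply: sorted_codeP; first by case: (s).
    by move: l_sort; rewrite e1 => /cat_sorted2 [].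
  by move: l_all; rewrite e1 all_cat => /andP[].
have [p2 ep2] : exists p2, code p2 = lab (ptgt q) :: t.
  apply: sorted_codeP => //.
    by move: l_sort; rewrite e2 => /cat_sorted2 [].
  by move: l_all; rewrite e2 all_cat => /andP[].
have p1q : ptgt p1 = psrc q.
  by apply: lab_inj; rewrite -(last_code p1 0) ep1 last_rcons.
have qp2 : ptgt q = psrc p2 by apply: lab_inj; case: ep2 => ->.
exists p1, p2; split=> //; apply: code_inj.
by rewrite code_pcat ?psrc_pcat // code_pcat // ep1 ep2 e cat_rcons.
Qed.

(** * Vanishing and nonvanishing of paths in the quotient algebra *)

Section Presented.
Local Open Scope ring_scope.
Variables (k : fieldType) (A : falgType k).
Variable f : {lrmorphism path_algebra k Q -> A}.
Hypothesis f_surj : forall a, exists x, f x = a.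
Hypothesis f_ker : forall x, f x = 0 <-> in_ideal (@cluster_relation k n Q) x.

Lemma relation_eq0 x : cluster_relation x -> f x = 0.
Proof.
move=> rx; apply/f_ker; exists [:: (1, x, 1)].
by split=> [t|]; [rewrite inE => /eqP -> | rewrite big_seq1 mul1r mulr1].
Qed.

Lemma zero_words_eq0 p : code p \in zs -> f (pathb k p) = 0.
Proof.
by move=> hp; apply/relation_eq0/cluster_relation_words; left; exists p.
Qed.

Lemma comm_words_eq p q : (code p, code q) \in cs ->
  f (pathb k p) = f (pathb k q).
Proof.
move=> hpq; apply/eqP; rewrite -subr_eq0 -linearB; apply/eqP.
by apply/relation_eq0/cluster_relation_words; right; exists p, q.
Qed.

Lemma pathb_pcat3 (p q r : qpath Q) : ptgt p = psrc q -> ptgt q = psrc r ->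
  pathb k (pcat p (pcat q r)) = pathb k p * pathb k q * pathb k r.
Proof.
move=> pq qr; rewrite -mulrA pathbM qr eqxx pathbM psrc_pcat //.
by rewrite pq eqxx.
Qed.

Lemma has_zero_eq0 p : has_zero zs (code p) -> f (pathb k p) = 0.
Proof.
case/hasP=> c czero /infixP [s [t e]].
have [q eq] := zero_words_code czero; subst c.
have [p1 [p2 [h1 h2 _ _ ->]]] := code_infix e.
by rewrite pathb_pcat3 // !rmorphM /= (zero_words_eq0 czero) mulr0 mul0r.
Qed.

Lemma swaps_eq p w : w \in swaps cs (code p) ->
  exists2 q, code q = w & f (pathb k q) = f (pathb k p).
Proof.
case/swapsP=> s [t [[c d] [cd /= e ->]]].
have [q [q' [ec ed es et]]] := comm_words_code cd; subst c d.
have [p1 [p2 [h1 h2 c1 c2 ->]]] := code_infix e.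
exists (pcat p1 (pcat q' p2)).
  rewrite code_pcat ?psrc_pcat -?et // -?es // code_pcat -?et // c1 c2.
  by rewrite /= cat_rcons es.
by rewrite !pathb_pcat3 -?es -?et // !rmorphM /= (comm_words_eq cd).
Qed.

Lemma word_class_eq p w : w \in word_class cs (code p) ->
  exists2 q, code q = w & f (pathb k q) = f (pathb k p).
Proof.
rewrite /word_class; elim: 3%N w => [|d IH] w /=.
  by rewrite inE => /eqP ->; exists p.
rewrite mem_undup mem_cat => /orP[/IH //|/flatten_mapP [w' /IH [q <- eq]]].
by case/swaps_eq=> q' eq' eqq'; exists q'; rewrite // eqq'.
Qed.

Lemma null_eq0 p : null zs cs (code p) -> f (pathb k p) = 0.
Proof. by case/hasP=> w /word_class_eq [q <- <-]; apply: has_zero_eq0. Qed.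

Definition class_indicator (s : seq (seq nat)) : path_algebra k Q -> k^o :=
  linext (fun p => (code p \in s)%:R : k^o).

HB.instance Definition _ s := GRing.Linear.copy (class_indicator s)
  (linext (fun p => (code p \in s)%:R : k^o)).

Lemma class_indicator_pathb s p : class_indicator s (pathb k p) = (code p \in s)%:R.
Proof. exact: linext_pathb. Qed.

(** By linearity [u] and [v] may be taken to be paths. A zero relation then gives a path outside
    [s], or 0; a commutativity relation gives 0 or a difference of two paths exchanged by a swap,
    which lie both in [s] or both outside. *)
Lemma class_indicator_relation s x u v : indicator_class zs cs s ->
  cluster_relation x -> class_indicator s (u * x * v) = 0.
Proof.
move=> /allP good rx; move: u.
apply: linear_eq0 => [c u u'|p].
  by rewrite !mulrDl -!scalerAl linearP.
move: v; apply: linear_eq0 => [c v v'|q].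
  by rewrite mulrDr -scalerAr linearP.
have pathb3 (r : qpath Q) : pathb k p * pathb k r * pathb k q =
    if (ptgt p == psrc r) && (ptgt r == psrc q) then pathb k (pcat p (pcat r q))
    else 0.
  case: eqP => [pr|npr]; last by rewrite pathbM; case: eqP => // _; rewrite mul0r.
  case: eqP => [rq|nrq]; first by rewrite pathb_pcat3.
  by rewrite -mulrA [pathb k r * _]pathbM; case: eqP => // _; rewrite mulr0.
have code3 (r : qpath Q) : ptgt p = psrc r -> ptgt r = psrc q ->
    code (pcat p (pcat r q)) =
    belast (lab (psrc p)) (behead (code p)) ++ code r ++ behead (code q).
  move=> pr rq; rewrite code_pcat ?psrc_pcat // code_pcat // {1}[code p]lastI.
  by rewrite cat_rcons -[last _ _]/(last 0%N (code p)) last_code pr.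
have [[r rzero ->]|[r1 [r2 [r12 ->]]]] := (cluster_relation_words x).1 rx.
  rewrite pathb3; case: andP => [[/eqP pr /eqP rq]|_]; last exact: linear0.
  rewrite class_indicator_pathb; case: (boolP (_ \in s)) => // /good /andP[/negP[]].
  apply/hasP; exists (code r) => //; rewrite code3 //.
  by apply/infixP; do 2!eexists.
have [q1 [q2 [/code_inj e1 /code_inj e2 es et]]] := comm_words_code r12.
subst q1 q2; rewrite mulrBr mulrBl !pathb3 es et.
case: andP => [[/eqP pr /eqP rq]|_]; last by rewrite subrr linear0.
rewrite linearB /= !class_indicator_pathb !code3 ?es ?et //.
set u := belast _ _; set w := behead _.
have swap_in c d : (c, d) \in cs -> c != [::] ->
    u ++ c ++ w \in s -> u ++ d ++ w \in s.
  move=> cd c0 /good /andP[_ /allP h]; apply: h.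
  exact: (@mem_swaps _ u w (c, d)).
have -> : (u ++ code r1 ++ w \in s) = (u ++ code r2 ++ w \in s).
  by apply/idP/idP; apply: swap_in => //; apply: comm_wordsC.
by rewrite subrr.
Qed.

Lemma class_indicator_factor s : indicator_class zs cs s ->
  exists h : {linear A -> k^o},
    forall p, h (f (pathb k p)) = (code p \in s)%:R.
Proof.
move=> good; have [|x fx0|h hE] := @linear_factor _ _ _ _ f (class_indicator s).
- exact: f_surj.
- have [l [lR ->]] := (f_ker x).1 fx0.
  rewrite linear_sum big_seq big1 // => t /lR.
  exact: class_indicator_relation.
by exists h => p; rewrite hE; apply: class_indicator_pathb.
Qed.

Lemma casimir_words_Frobdim om : casimir_words n.+1 adj om ->
  (0 < Frobdim A)%N.
Proof.
case/and3P=> /allP om_pairs /allP om_bal om_n0.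
(* The class in [A] of the path with word [w]; words that encode no path get the value 0. *)
have val_ex w : exists a, forall p, code p = w -> f (pathb k p) = a.
  case: (classic (exists p, code p = w)) => [[p ep]|np].
    exists (f (pathb k p)) => q eq; congr (f (pathb k _)).
    by apply: code_inj; rewrite eq.
  by exists 0 => p ep; case: np; exists p.
pose val w := sval (constructive_indefinite_description _ (val_ex w)).
have valE p : val (code p) = f (pathb k p).
  by rewrite /val; case: constructive_indefinite_description => a /= ->.
pose T (t : seq nat * seq nat) : tensor_square A := tens (val t.1) (val t.2).
have pairP t : t \in om -> exists p q,
    t = (code p, code q) /\ psrc p = ptgt q.
  case: t => x y /om_pairs /and5P[x0 y0 sx sy /and3P[lx ly /eqP e]].
  have [p ep] := sorted_codeP x0 sx lx; have [q eq] := sorted_codeP y0 sy ly.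
  exists p, q; rewrite ep eq; split=> //; apply: lab_inj.
  by move: e; rewrite -ep -eq /= -(last_code q 0%N).
apply: (@Frobdim_gt0 _ _ (\sum_(t <- om) T t)).
  case/hasP: om_n0 => t0 _ /and3P[/class_indicator_factor [h1 h1E]
    /class_indicator_factor [h2 h2E] /eqP cnt].
  have [||g [gE _]] := @tens_universal _ A k^o (fun a b => h1 a *: h2 b).
  + by move=> b c x y; rewrite linearP scalerDl scalerA.
  + by move=> a c x y; rewrite linearP scalerDr !scalerA mulrC.
  (* Under [g] each summand becomes 1 or 0 according to membership in the two classes, and exactly
     one becomes 1. *)
  apply/eqP => /(congr1 g); rewrite linear0 linear_sum.
  rewrite (eq_big_seq (fun t => ((t.1 \in word_class cs t0.1) &&
     (t.2 \in word_class cs t0.2))%:R : k^o)).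
    rewrite -natr_sum (eq_bigr (fun t => if (t.1 \in word_class cs t0.1) &&
     (t.2 \in word_class cs t0.2) then 1%N else 0%N)); last first.
      by move=> t _; case: (_ && _).
    by rewrite -big_mkcond sum1_count cnt => /eqP; rewrite oner_eq0.
  move=> t /pairP [p [q [-> _]]]; rewrite /T /= gE !valE h1E h2E.
  by case: (_ \in _); case: (_ \in _); rewrite ?scale1r ?scale0r.
pose S x := lact x (\sum_(t <- om) T t) = ract (\sum_(t <- om) T t) x.
suff SF x : S (f x) by move=> a; have [x <-] := f_surj a; apply: SF.
elim/path_algebra_ind: x => [c x y Sx Sy||i|a x Sx].
- by rewrite /S linearP lactP ractP Sx Sy.
- by rewrite /S linear0 lact0 ract0.
- rewrite /S lact_sum ract_sum; apply: eq_big_seq => t /pairP [p [q [-> pq]]].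
  rewrite /T lactE ractE !valE -!rmorphM /= vertexM_pathb pathbM_vertex pq eq_sym.
  by case: eqP => // _; rewrite linear0 tens0l tens0r.
(* The induction hypothesis moves [x] to the right, leaving commutation with the arrow [a]. *)
rewrite /S rmorphM lactM Sx lact_ract ractM; congr (ract _ _) => {x Sx}.
pose uv := (lab (src a), lab (tgt a)).
pose coded t := exists p q, t = (code p, code q).
have T_live s : {in s, forall t, coded t} ->
    \sum_(t <- filter (live zs cs) s) T t = \sum_(t <- s) T t.
  move=> sc; rewrite big_filter big_mkcond; apply: eq_big_seq => t /sc [p [q ->]].
  rewrite /live /T /= !valE; case: (boolP (null _ _ (code p))) => [/null_eq0 ->|_].
    by rewrite tens0l.
  by case: (boolP (null _ _ (code q))) => [/null_eq0 ->|_] //; rewrite tens0r.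
have T_balanced s s' : {in s, forall t, coded t} -> balanced cs s s' ->
    \sum_(t <- s) T t = \sum_(t <- s') T t.
  move=> sc /hasP [s'']; rewrite mem_permutations => perm_s.
  rewrite -(perm_big _ perm_s) /= {s' perm_s}.
  elim: s s'' sc => [|t s IH] [|t' s''] sc //= /andP[/andP[t1 t2] h].
  rewrite !big_cons (IH s'') // => [|t0 t0s]; last first.
    by apply: sc; rewrite inE t0s orbT.
  congr (_ + _); have [p [q et]] := sc t (mem_head _ _).
  move: t1 t2; rewrite et /= => /word_class_eq [p' ep' fp'] /word_class_eq [q' eq' fq'].
  by rewrite /T /= -ep' -eq' !valE fp' fq'.
have left_coded : {in extend_left om uv, forall t, coded t}.
  move=> t' /mapP [t]; rewrite mem_filter => /andP[/eqP e /pairP [p [q [et _]]]] ->.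
  have ap : ptgt (arrow_path a) = psrc p by apply: lab_inj; move: e; rewrite et.
  exists (pcat (arrow_path a) p), q; rewrite et code_pcat //=; congr (_ :: _, _).
  by rewrite /code -ap.
have right_coded : {in extend_right om uv, forall t, coded t}.
  move=> t' /mapP [t]; rewrite mem_filter => /andP[/eqP e /pairP [p [q [et _]]]] ->.
  have qa : ptgt q = psrc (arrow_path a).
    by apply: lab_inj; rewrite -(last_code q 0%N); move: e; rewrite et.
  by exists p, (pcat q (arrow_path a)); rewrite et code_pcat //= cats1.
transitivity (\sum_(t <- extend_left om uv) T t).
  rewrite lact_sum big_map big_filter [RHS]big_mkcond.
  apply: eq_big_seq => t /pairP [p [q [-> _]]].
  rewrite /T lactE !valE -rmorphM pathbM /= (inj_eq lab_inj) eq_sym.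
  rewrite -[ptgt _]/(tgt a); case: eqP => [e|_]; last by rewrite linear0 tens0l.
  have -> : lab (src a) :: code p = code (pcat (arrow_path a) p).
    have ap : ptgt (arrow_path a) = psrc p by rewrite -[ptgt _]/(tgt a) e.
    by rewrite code_pcat //= /code -ap.
  by rewrite valE.
transitivity (\sum_(t <- extend_right om uv) T t); last first.
  rewrite ract_sum big_map big_filter big_mkcond.
  apply: eq_big_seq => t /pairP [p [q [-> _]]].
  rewrite /T ractE !valE -rmorphM pathbM [last _ _]last_code (inj_eq lab_inj).
  rewrite -[psrc (arrow_path a)]/(src a).
  case: (ptgt q =P src a) => [e|_]; last by rewrite /= linear0 tens0r.
  have -> : rcons (code q) (lab (tgt a)) = code (pcat q (arrow_path a)).
    by rewrite code_pcat //= cats1.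
  by rewrite valE.
rewrite -(T_live (extend_left _ _)) // -(T_live (extend_right _ _)) //.
apply: T_balanced => [t|]; first by rewrite mem_filter => /andP[_ /left_coded].
by apply: om_bal; apply/arrow_words_arrow; exists a.
Qed.
End Presented.
End LabelledQuiver.

(** * The mutation class of E6 *)

Section MutationClass.
Local Open Scope nat_scope.

(* A quiver on {0, ..., 5} is given by the list of its out-neighbourhoods. *)
Definition out_adj (nb : seq (seq nat)) : rel nat := fun u v => v \in nth [::] nb u.

Definition signed_adj (nb : seq (seq nat)) (u v : nat) : int :=
  ((out_adj nb u v)%:Z - (out_adj nb v u)%:Z)%R.

(** Fomin-Zelevinsky mutation on functions of numbers, in a form that can be evaluated. *)
Definition mutated (r : nat) (M : nat -> nat -> int) (u v : nat) : int :=
  (if (u == r) || (v == r) then - M u v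
   else M u v + Num.max (M u r) 0 * Num.max (M r v) 0
              - Num.max (- M u r) 0 * Num.max (- M r v) 0)%R.

(* The i-th bit of [s] reverses the i-th edge. *)
Definition oriented_E6 (s : bitseq) (u v : nat) : int :=
  (if (u, v) \in E6_edges then (-1) ^+ nth false s (index (u, v) E6_edges)
   else if (v, u) \in E6_edges then - (-1) ^+ nth false s (index (v, u) E6_edges)
   else 0)%R.

(** Only entries equal to 1 are read; [relabels] later compares every entry, so no multiple arrow
    can go unnoticed. *)
Definition out_lists (M : nat -> nat -> int) : seq (seq nat) :=
  [seq [seq v <- iota 0 6 | M u v == 1%R] | u <- iota 0 6].

Definition relabels (M : nat -> nat -> int) (nb : seq (seq nat)) (p : seq nat) :=
  [&& size p == 6, uniq p, all (gtn 6) p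
    & all (fun u => all (fun v => M u v == signed_adj nb (nth 0 p u) (nth 0 p v))
                        (iota 0 6)) (iota 0 6)].

(* An isomorphism invariant, only there to speed up the search. *)
Definition degrees (nb : seq (seq nat)) :=
  sort leq [seq 7 * size (nth [::] nb u) + count (fun l => u \in l) nb | u <- iota 0 6].

Definition find_relabelling (perms : seq (seq nat)) (nb nb' : seq (seq nat)) :
    option (seq nat) :=
  if degrees nb == degrees nb' then
    ohead [seq p <- perms | all (fun u => all (fun v =>
       out_adj nb u v == out_adj nb' (nth 0 p u) (nth 0 p v)) (iota 0 6)) (iota 0 6)]
  else None.

Fixpoint locate (perms : seq (seq nat)) (i : nat) (reps : seq (seq (seq nat))) nb :
    option (nat * seq nat) :=
  if reps is nb' :: reps' then
    if find_relabelling perms nb nb' is Some p then Some (i, p)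
    else locate perms i.+1 reps' nb
  else None.

Definition mutants nb := [seq out_lists (mutated r (signed_adj nb)) | r <- iota 0 6].

(** One round of breadth-first search up to isomorphism; the second component collects the quivers
    found in this round. *)
Definition grow perms (reps new : seq (seq (seq nat))) :=
  foldl (fun st nb => if locate perms 0 st.1 nb is Some _ then st
                      else (rcons st.1 nb, rcons st.2 nb))
        (reps, [::]) (flatten [seq mutants nb | nb <- new]).

Fixpoint mutation_closure perms d reps new :=
  if d is d'.+1 then let st := grow perms reps new in mutation_closure perms d' st.1 st.2
  else reps.

(** Ten rounds from one orientation; that they exhaust the class is verified by
    [E6_mutations_relabel] and [E6_orientations_relabel]. *)
Definition E6_quivers : seq (seq (seq nat)) := Eval vm_compute in
  let nb := out_lists (oriented_E6 [::]) in
  mutation_closure (permutations (iota 0 6)) 10 [:: nb] [:: nb].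

(** The default marks a failed search; [relabels] rejects it, as the empty list does not have size
    6. *)
Definition E6_mutation_table : seq (seq (nat * seq nat)) := Eval vm_compute in
  let perms := permutations (iota 0 6) in
  [seq [seq odflt (0, [::]) (locate perms 0 E6_quivers nb') | nb' <- mutants nb]
  | nb <- E6_quivers].

Fixpoint bitseqs (n : nat) : seq bitseq :=
  if n is n'.+1 then
    flatten [seq [:: true :: s; false :: s] | s <- bitseqs n'] else [:: [::]].

Definition E6_orientation_table : seq (nat * seq nat) := Eval vm_compute in
  let perms := permutations (iota 0 6) in
  [seq odflt (0, [::]) (locate perms 0 E6_quivers (out_lists (oriented_E6 s)))
  | s <- bitseqs 5].

Definition simple_lists (nb : seq (seq nat)) : bool :=
  all (fun u => all (fun v => ~~ (out_adj nb u v && out_adj nb v u)) (iota 0 6)) (iota 0 6).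

Definition relabels_E6_quiver (M : nat -> nat -> int) (t : nat * seq nat) : bool :=
  (t.1 < size E6_quivers) && relabels M (nth [::] E6_quivers t.1) t.2.

Lemma E6_mutations_relabel :
  all (fun i => all (fun r =>
      has (relabels_E6_quiver (mutated r (signed_adj (nth [::] E6_quivers i))))
          (nth [::] E6_mutation_table i)) (iota 0 6))
    (iota 0 (size E6_quivers)).
Proof. by vm_compute. Qed.

Lemma E6_orientations_relabel :
  all (fun s => has (relabels_E6_quiver (oriented_E6 s)) E6_orientation_table)
      (bitseqs 5).
Proof. by vm_compute. Qed.

Lemma mem_bitseqs s : s \in bitseqs (size s).
Proof.
elim: s => [|b s IH] //=; apply/flatten_mapP; exists s => //.
by case: b; rewrite !inE eqxx ?orbT.
Qed.

Definition entries (B : 'M[int]_6) (M : nat -> nat -> int) (lab : 'I_6 -> nat) : Prop :=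
  [/\ forall i, lab i < 6, injective lab & forall i j, B i j = M (lab i) (lab j)].

Lemma entries_relabels B M lab nb p : entries B M lab -> relabels M nb p ->
  entries B (signed_adj nb) (fun i => nth 0 p (lab i)).
Proof.
case=> lab_lt lab_inj BE /and4P[/eqP sp up /allP lp /allP h]; split=> [i|i j|i j].
- by apply: (lp _ (mem_nth 0 _)); rewrite sp.
- by move/eqP; rewrite nth_uniq ?sp // => /eqP /lab_inj.
- have iP l : lab l \in iota 0 6 by rewrite mem_iota add0n lab_lt.
  by rewrite BE; apply/eqP; apply: (allP (h _ (iP i))).
Qed.

Lemma entries_mutation B M lab r : entries B M lab ->
  entries (mutation r B) (mutated (lab r) M) lab.
Proof.
case=> lab_lt lab_inj BE; split=> // i j.
by rewrite mxE /mutated !(inj_eq lab_inj) !BE.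
Qed.

Lemma entries_oriented B : E6_orientation B ->
  exists2 s, size s = 5 & entries B (oriented_E6 s) val.
Proof.
case=> skew absB.
(* The sign of [B] along each edge; the opposite entries follow by skew symmetry. *)
pose s := [seq B (inord e.1) (inord e.2) == - 1%R | e <- E6_edges]%R.
exists s; first by rewrite size_map.
split=> [i|i j|i j]; [exact: ltn_ord | exact: val_inj |].
have BN i' j' : (B i' j' = - B j' i')%R.
  by have := congr1 (fun M : 'M_6 => M j' i') skew; rewrite !mxE.
have signE i' j' : (val i', val j') \in E6_edges ->
    (B i' j' = (-1) ^+ nth false s (index (val i', val j') E6_edges))%R.
  move=> ij; rewrite (nth_map (0, 0)) ?index_mem // nth_index // !inord_val.
  have := absB i' j'; rewrite ij /=; case: eqP => [-> //|ne].
  by move/eqP; rewrite eqr_norml => /andP[/orP[/eqP ->|/eqP /ne]].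
rewrite /oriented_E6; case: ifP => [/signE //|nij].
case: ifP => [/signE e|nji]; first by rewrite BN e.
by have /eqP := absB i j; rewrite nij nji normr_eq0 => /eqP.
Qed.

Lemma entries_quiver B M lab t : entries B M lab -> relabels_E6_quiver M t ->
  exists i lab', i < size E6_quivers /\
    entries B (signed_adj (nth [::] E6_quivers i)) lab'.
Proof.
move=> BM /andP[lt rel]; exists t.1; eexists; split=> //.
exact: entries_relabels BM rel.
Qed.

(** Induction on the mutation sequence: mutation commutes with relabelling, so each step reduces to
    a mutation of a listed quiver. *)
Lemma E6_mutation_class_quivers B : E6_mutation_class B ->
  exists i lab, i < size E6_quivers /\
    entries B (signed_adj (nth [::] E6_quivers i)) lab.
Proof.
case=> B0 [s [ori ->]]; elim/last_ind: s => [|s r [i [lab [i_lt Bi]]]].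
  have [s ss Bs] := entries_oriented ori.
  have := mem_bitseqs s; rewrite ss => /(allP E6_orientations_relabel) /hasP [t _].
  exact: entries_quiver Bs.
rewrite foldl_rcons; have := allP E6_mutations_relabel i; rewrite mem_iota.
move=> /(_ i_lt) /allP /(_ (lab r)); rewrite mem_iota; case: (Bi) => lab_lt _ _.
move=> /(_ (lab_lt r)) /hasP [t _]; exact: entries_quiver (entries_mutation r Bi).
Qed.

Lemma labelled_quiver_of_mx B nb lab : simple_lists nb ->
  entries B (signed_adj nb) lab -> labelled_by (quiver_of_mx B) (out_adj nb) lab.
Proof.
move=> /allP nb_simple [lab_lt lab_inj BE].
have one_way i j : ~~ (out_adj nb (lab i) (lab j) && out_adj nb (lab j) (lab i)).
  have iP l : lab l \in iota 0 6 by rewrite mem_iota add0n lab_lt.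
  exact: (allP (nb_simple _ (iP i)) _ (iP j)).
(* Without oriented 2-cycles nothing cancels in [signed_adj], so its positive part is the adjacency
   relation. *)
have arrows i j : absz (Num.max (B i j) 0%R) = out_adj nb (lab i) (lab j).
  rewrite BE /signed_adj; have := one_way i j.
  by case: (out_adj _ _ _); case: (out_adj _ _ _).
split=> [//|//|[[i j] x]|i j ij|[[i j] x] [[i' j'] x']].
- by case: x => m; rewrite /= arrows /=; case: (out_adj _ _ _).
- have lt : 0 < absz (Num.max (B i j) 0%R) by rewrite arrows ij.
  by exists (existT _ (i, j) (Ordinal lt)).
- rewrite /= => ei ej; subst i' j'; congr existT.
  apply: val_inj; case: x x' => m lt [m' lt'] /=; rewrite /= arrows in lt lt'.
  by case: (out_adj _ _ _) lt lt'; rewrite ?ltn0 // !ltnS !leqn0 => /eqP -> /eqP ->.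
Qed.

(* An empty result is returned for the quivers without relations. *)
Definition find_casimir (nb : seq (seq nat)) : seq (seq nat * seq nat) :=
  let adj := out_adj nb in
  let zs := zero_words 6 adj in let cs := comm_words 6 adj in
  if zs == [::] then [::] else
  let ws := [seq w <- flatten [seq words_from 6 adj 6 u | u <- iota 0 6]
            | ~~ null zs cs w] in
  let xs := [seq x <- ws
            | all (fun u => adj u (head 0 x) ==> null zs cs (u :: x)) (iota 0 6)] in
  let ys := [seq y <- ws
            | all (fun v => adj (last 0 y) v ==> null zs cs (rcons y v)) (iota 0 6)] in
  let simple := [seq t <- [seq (x, y) | x <- xs, y <- ys]
                | head 0 t.1 == last 0 t.2] in
  if simple is t :: _ then [:: t] else
  let double := [seq om <- flatten [seq [seq [:: (x, rcons y uv.2); (uv.1 :: x, y)]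
     | x <- [seq x <- ws | (head 0 x == uv.2) && ~~ null zs cs (uv.1 :: x)],
       y <- [seq y <- ws | (last 0 y == uv.1) && ~~ null zs cs (rcons y uv.2)]]
     | uv <- arrow_words 6 adj] | casimir_words 6 adj om] in
  head [::] double.

End MutationClass.

Definition E6_casimirs : seq (seq (seq nat * seq nat)) := Eval vm_compute in
  [seq find_casimir nb | nb <- E6_quivers].

(** Only the certificates are verified here; nothing depends on how [find_casimir] found them. *)
Lemma E6_quivers_casimir :
  all (fun i => let nb := nth [::] E6_quivers i in let adj := out_adj nb in
    simple_lists nb &&
    ((zero_words 6 adj == [::]) && (comm_words 6 adj == [::]) ||
     casimir_words 6 adj (nth [::] E6_casimirs i)))
  (iota 0 (size E6_quivers)).
Proof. by vm_compute. Qed.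

Theorem theoremC (k : closedFieldType) (A : falgType k)
    (hA : cluster_tilted_E6 A) (hnh : ~ hereditary A) :
  (1 <= Frobdim A)%N.
Proof.
case: hA => B [/E6_mutation_class_quivers [i [lab [i_lt BE]]] [f [f_surj f_ker]]].
have := allP E6_quivers_casimir i; rewrite mem_iota => /(_ i_lt) /= /andP[simple].
have hQ := labelled_quiver_of_mx simple BE.
case/orP=> [/andP[/eqP no_zero /eqP no_comm]|]; last first.
  exact: (casimir_words_Frobdim hQ f_surj f_ker).
(* Without relations the ideal is zero, so [f] is an isomorphism from the path algebra and [A] would
   be hereditary. *)
case: hnh; apply: (path_algebra_hereditary (f := f)).
have f_inj : injective f.
  apply: raddf_inj => x /f_ker [l [lR ->]]; rewrite big_seq big1 // => t /lR.
  case/(cluster_relation_words hQ) => [[p]|[p [q []]]].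
    by rewrite no_zero.
  by rewrite no_comm.
pose g a := sval (constructive_indefinite_description _ (f_surj a)).
have gK : cancel g f.
  by move=> a; rewrite /g; case: constructive_indefinite_description.
by exists g => // x; apply: f_inj; rewrite gK.
Qed.
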